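(* Let $\mathcal{X}$ be a real Banach space. A function $g:[a,b]\to\mathcal{X}^*$ is Henstock–Gel'fand integrable on $[a,b]$ if and only if $yg$ is Henstock integrable on $[a,b]$ for every $y\in\mathcal{X}$.
   Context: For $y\in\mathcal{X}$, $yg$ denotes $t\mapsto g(t)(y)$. A function $h:[a,b]\to\mathbb{R}$ is Henstock integrable on $[a,b]$ if there is $A\in\mathbb{R}$ such that for every $\epsilon>0$ there is a gauge $\delta:[a,b]\to(0,\infty)$ such that for every tagged partition $\{([u_k,z_k],t_k)\}_{k=1}^n$ of $[a,b]$ with $t_k\in[u_k,z_k]\subset(t_k-\delta(t_k),t_k+\delta(t_k))$ one has $|\sum_k h(t_k)(z_k-u_k)-A|<\epsilon$; $A=\mathcal{H}\int_a^b h$, and similarly on subintervals. A function $g:[a,b]\to\mathcal{X}^*$ is Henstock–Gel'fand integrable on $[a,b]$ if $yg$ is Henstock integrable on $[a,b]$ for each $y\in\mathcal{X}$ and for every interval $I\subset[a,b]$ there is $y_I^*\in\mathcal{X}^*$ with $y_I^*(y)=\mathcal{H}\int_I yg$ for all $y\in\mathcal{X}$. *)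

(* Defs.v *)
From Stdlib Require Import Reals Lra List.
Import ListNotations.
Open Scope R_scope.

Record Banach : Type := {
  carrier :> Type;
  vzero : carrier;
  vadd : carrier -> carrier -> carrier;
  vopp : carrier -> carrier;
  vscal : R -> carrier -> carrier;
  vnorm : carrier -> R;
  vadd_assoc : forall x y z, vadd x (vadd y z) = vadd (vadd x y) z;
  vadd_comm : forall x y, vadd x y = vadd y x;
  vadd_0 : forall x, vadd x vzero = x;
  vadd_opp : forall x, vadd x (vopp x) = vzero;
  vscal_assoc : forall a b x, vscal a (vscal b x) = vscal (a * b) x;
  vscal_1 : forall x, vscal 1 x = x;
  vscal_distr_v : forall a x y, vscal a (vadd x y) = vadd (vscal a x) (vscal a y);
  vscal_distr_s : forall a b x, vscal (a + b) x = vadd (vscal a x) (vscal b x);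
  vnorm_nonneg : forall x, 0 <= vnorm x;
  vnorm_zero : forall x, vnorm x = 0 -> x = vzero;
  vnorm_scal : forall a x, vnorm (vscal a x) = Rabs a * vnorm x;
  vnorm_triangle : forall x y, vnorm (vadd x y) <= vnorm x + vnorm y;
  vcomplete : forall u : nat -> carrier,
    (forall eps, 0 < eps -> exists N, forall m n, (N <= m)%nat -> (N <= n)%nat ->
        vnorm (vadd (u m) (vopp (u n))) < eps) ->
    exists l, forall eps, 0 < eps -> exists N, forall n, (N <= n)%nat ->
        vnorm (vadd (u n) (vopp l)) < eps
}.

Definition is_bounded_linear (X : Banach) (f : X -> R) : Prop :=
  (forall x y, f (vadd X x y) = f x + f y) /\
  (forall a x, f (vscal X a x) = a * f x) /\
  (exists M, forall x, Rabs (f x) <= M * vnorm X x).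

Definition dual (X : Banach) : Type := { f : X -> R | is_bounded_linear X f }.

Definition dual_app {X : Banach} (f : dual X) (y : X) : R := proj1_sig f y.

Definition ev_fun {X : Banach} (y : X) (g : R -> dual X) : R -> R :=
  fun t => dual_app (g t) y.

Fixpoint tagged_partition (c d : R) (P : list (R * R * R)) : Prop :=
  match P with
  | [] => c = d
  | (u, z, t) :: P' =>
      u = c /\ u < z /\ u <= t /\ t <= z /\ tagged_partition z d P'
  end.

Definition delta_fine (delta : R -> R) (P : list (R * R * R)) : Prop :=
  Forall (fun '(u, z, t) => t - delta t < u /\ z < t + delta t) P.

Definition riemann_sum (h : R -> R) (P : list (R * R * R)) : R :=
  fold_right (fun '(u, z, t) s => h t * (z - u) + s) 0 P.

Definition Henstock_integral (h : R -> R) (c d A : R) : Prop :=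
  forall eps, 0 < eps ->
    exists delta : R -> R,
      (forall t, c <= t <= d -> 0 < delta t) /\
      forall P, tagged_partition c d P -> delta_fine delta P ->
        Rabs (riemann_sum h P - A) < eps.

Definition Henstock_integrable (h : R -> R) (c d : R) : Prop :=
  exists A, Henstock_integral h c d A.

Definition Henstock_Gelfand_integrable (X : Banach) (g : R -> dual X) (a b : R) : Prop :=
  (forall y : X, Henstock_integrable (ev_fun y g) a b) /\
  (forall c d, a <= c -> c < d -> d <= b ->
     exists ystar : dual X, forall y : X,
       Henstock_integral (ev_fun y g) c d (dual_app ystar y)).

(* Main.v *)
Require Import Defs.
From Stdlib Require Import Reals ZArith Lra Lia List Classical ClassicalEpsilon.
From Stdlib Require Cantor.
Import ListNotations.
Open Scope R_scope.

(* Write [Phi y u z] for the integral of [yg] over [u, z]; only the boundedness of [Phi] in [y]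
   is at stake. Call a point singular if it has no neighbourhood in which all intervals give a
   bounded functional. The singular set is closed, and by Cousin's lemma an interval that misses
   it gives a bounded functional. Suppose that it is not empty. By the Saks-Henstock lemma and
   Baire's theorem on the singular set, for every [y] the indefinite integral of [yg] is VB* on
   some rational portion of that set; by Baire's theorem on [X], one portion and one bound serve
   a set of [y] that is dense in a ball. Writing a vector as a series with geometrically
   decreasing variations (Zabreiko's lemma) and integrating the series term by term by a gauge
   argument bounds [Phi] on all intervals that meet the portion, which contradicts singularity. *)

(** For a fixed interval the integral of [yg] is a limit of Riemann sums, each of which is a bounded
    functional of [y]. The limit, however, runs along gauges that depend on [y] and not along a
    sequence, so the uniform boundedness principle does not give the bound. Estimates by the
    integral of the absolute value fail as well, since a Henstock integrable function need not be
    absolutely integrable; the variation can be controlled only locally. Where it is finite depends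
    on [y], hence the portions come from a countable family. Neither of the two families of sets fed
    to Baire's theorem is known to be closed: a gauge may be arbitrarily irregular, and closedness
    of the set of vectors with a given variation would follow from the continuity of [Phi] in [y],
    the very thing to be proved. The category theorem is therefore used in the form that some set is
    dense in a ball, and the missing closedness is made up for separately: on the line by moving
    tags inside slightly enlarged intervals, in [X] by the series expansion. *)

(** * Finite sums over lists *)

Definition lsum {A : Type} (f : A -> R) (l : list A) : R :=
  fold_right (fun x s => f x + s) 0 l.

Lemma lsum_app {A} (f : A -> R) l1 l2 : lsum f (l1 ++ l2) = lsum f l1 + lsum f l2.
Proof. induction l1 as [|x l1 IH]; simpl; [lra | rewrite IH; lra]. Qed.

Lemma lsum_le {A} (f g : A -> R) l :
  (forall x, In x l -> f x <= g x) -> lsum f l <= lsum g l.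
Proof.
  induction l as [|x l IH]; simpl; intros H; [lra|].
  assert (f x <= g x) by (apply H; now left).
  assert (lsum f l <= lsum g l) by (apply IH; intros; apply H; now right). lra.
Qed.

Lemma lsum_ext {A} (f g : A -> R) l :
  (forall x, In x l -> f x = g x) -> lsum f l = lsum g l.
Proof. intros H; apply Rle_antisym; apply lsum_le; intros x Hx; rewrite (H x Hx); lra. Qed.

Lemma lsum_plus {A} (f g : A -> R) l : lsum (fun x => f x + g x) l = lsum f l + lsum g l.
Proof. induction l as [|x l IH]; simpl; [lra | rewrite IH; lra]. Qed.

Lemma lsum_scal {A} (c : R) (f : A -> R) l : lsum (fun x => c * f x) l = c * lsum f l.
Proof. induction l as [|x l IH]; simpl; [lra | rewrite IH; lra]. Qed.

Lemma lsum_const0 {A} (l : list A) : lsum (fun _ => 0) l = 0.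
Proof. induction l as [|x l IH]; simpl; [lra | rewrite IH; lra]. Qed.

Lemma lsum_nonneg {A} (f : A -> R) l : (forall x, In x l -> 0 <= f x) -> 0 <= lsum f l.
Proof. intros H; rewrite <- (lsum_const0 l); now apply lsum_le. Qed.

Lemma lsum_Rabs {A} (f : A -> R) l : Rabs (lsum f l) <= lsum (fun x => Rabs (f x)) l.
Proof.
  induction l as [|x l IH]; simpl; [rewrite Rabs_R0; lra|].
  eapply Rle_trans; [apply Rabs_triang | lra].
Qed.

Lemma lsum_map {A B} (f : B -> R) (g : A -> B) l : lsum f (map g l) = lsum (fun x => f (g x)) l.
Proof. induction l as [|x l IH]; simpl; [lra | rewrite IH; lra]. Qed.

Lemma lsum_swap {A B} (f : A -> B -> R) l m :
  lsum (fun x => lsum (f x) m) l = lsum (fun y => lsum (fun x => f x y) l) m.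
Proof.
  induction l as [|x l IH]; simpl; [now rewrite lsum_const0|].
  now rewrite IH, lsum_plus.
Qed.

Lemma lsum_ge_term {A} (f : A -> R) l x :
  (forall y, In y l -> 0 <= f y) -> In x l -> f x <= lsum f l.
Proof.
  induction l as [|y l IH]; simpl; intros H Hx; [easy|].
  assert (0 <= lsum f l) by (apply lsum_nonneg; intros; apply H; now right).
  destruct Hx as [->|Hx]; [lra|].
  assert (f x <= lsum f l) by (apply IH; auto).
  assert (0 <= f y) by (apply H; now left). lra.
Qed.

Lemma lsum_filter_split {A} (f : A -> R) (b : A -> bool) l :
  lsum f l = lsum f (filter b l) + lsum f (filter (fun x => negb (b x)) l).
Proof.
  induction l as [|x l IH]; simpl; [lra|].
  destruct (b x); simpl; rewrite IH; lra.
Qed.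

Lemma lsum_filter {A} (f : A -> R) (b : A -> bool) l :
  lsum f (filter b l) = lsum (fun x => if b x then f x else 0) l.
Proof.
  induction l as [|x l IH]; simpl; [lra|].
  destruct (b x); simpl; rewrite IH; lra.
Qed.

Lemma lsum_geom (K : R) (n len : nat) :
  0 <= K -> lsum (fun k => K / 2 ^ k) (seq n len) <= 2 * K / 2 ^ n.
Proof.
  intros HK; revert n; induction len as [|len IH]; intros n; simpl.
  - apply Rmult_le_pos; [lra|]. left; apply Rinv_0_lt_compat, pow_lt; lra.
  - specialize (IH (S n)). simpl in IH.
    assert (0 < 2 ^ n) by (apply pow_lt; lra).
    replace (2 * K / (2 * 2 ^ n)) with (K / 2 ^ n) in IH by (field; lra).
    replace (2 * K / 2 ^ n) with (K / 2 ^ n + K / 2 ^ n) by (field; lra). lra.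
Qed.

(* Each item is charged to its own class [N x]; classes are summed geometrically. *)
Lemma lsum_by_classes {A} (f : nat -> A -> R) (N : A -> nat) (eps : R) l :
  0 <= eps -> (forall m x, In x l -> 0 <= f m x) ->
  (forall m, lsum (f m) (filter (fun x => Nat.eqb (N x) m) l) <= eps / 2 ^ m) ->
  lsum (fun x => f (N x) x) l <= 2 * eps.
Proof.
  intros Heps Hf Hm.
  assert (HL : exists L, forall x, In x l -> (N x < L)%nat).
  { clear. induction l as [|x l [L HL]]; [exists 0%nat; easy|].
    exists (L + S (N x))%nat; intros y [->|Hy]; [lia | specialize (HL y Hy); lia]. }
  destruct HL as [L HL].
  apply Rle_trans with (lsum (fun m => lsum (f m) (filter (fun x => Nat.eqb (N x) m) l)) (seq 0 L)).
  - rewrite (lsum_ext (fun m => lsum (f m) (filter (fun x => Nat.eqb (N x) m) l))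
      (fun m => lsum (fun x => if Nat.eqb (N x) m then f m x else 0) l));
      [|intros; apply lsum_filter].
    rewrite <- (lsum_swap (fun x m => if Nat.eqb (N x) m then f m x else 0)).
    apply lsum_le; intros x Hx.
    eapply Rle_trans;
      [|apply (lsum_ge_term (fun m => if Nat.eqb (N x) m then f m x else 0)) with (x := N x)].
    + rewrite Nat.eqb_refl; lra.
    + intros m _; destruct (Nat.eqb (N x) m); [now apply Hf | lra].
    + apply in_seq; specialize (HL x Hx); lia.
  - eapply Rle_trans; [apply lsum_le; intros m _; apply Hm|].
    pose proof (lsum_geom eps 0 L Heps) as HG; simpl in HG. lra.
Qed.

Lemma inv_pow2_small (K eps : R) : 0 < eps -> exists N, K / 2 ^ N <= eps.
Proof.
  intros He. destruct (INR_unbounded (K / eps)) as [N HN]. exists N.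
  assert (HP : INR N <= 2 ^ N).
  { clear. induction N as [|N IH]; [simpl; lra|]. rewrite S_INR; simpl.
    assert (1 <= 2 ^ N) by (apply pow_R1_Rle; lra). lra. }
  assert (0 < 2 ^ N) by (apply pow_lt; lra).
  apply Rmult_le_reg_r with (2 ^ N); [easy|].
  unfold Rdiv; rewrite Rmult_assoc, Rinv_l by lra.
  assert (K / eps * eps = K) by (field; lra). nra.
Qed.

Lemma inv_INR_small (eps : R) : 0 < eps -> exists k, / INR (S k) < eps.
Proof.
  intros He. destruct (INR_unbounded (/ eps)) as [N HN]. exists N.
  rewrite <- (Rinv_inv eps). apply Rinv_lt_contravar.
  - apply Rmult_lt_0_compat; [now apply Rinv_0_lt_compat | apply lt_0_INR; lia].
  - rewrite S_INR; lra.
Qed.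

(** * The Baire category theorem *)

(** If no [W n] were dense in a relative ball of [D], every ball would contain a smaller one that
    misses [W n]. Doing this for all [n] in turn gives nested balls whose centres converge to a
    point of [D] outside every [W n]. *)
Lemma baire (T : Type) (D : T -> Prop) (d : T -> T -> R) (W : nat -> T -> Prop) :
  (forall x, d x x = 0) -> (forall x y, d x y = d y x) ->
  (forall x y z, d x z <= d x y + d y z) ->
  (forall u : nat -> T, (forall n, D (u n)) ->
     (forall eps, 0 < eps -> exists N, forall m n, (N <= m)%nat -> (N <= n)%nat ->
        d (u m) (u n) < eps) ->
     exists l, D l /\ forall eps, 0 < eps -> exists N, forall n, (N <= n)%nat -> d (u n) l < eps) ->
  (exists x, D x) -> (forall x, D x -> exists n, W n x) ->
  exists n x r, D x /\ 0 < r /\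
    forall x', D x' -> d x x' < r -> forall eps, 0 < eps ->
      exists w, D w /\ W n w /\ d x' w < eps.
Proof.
  intros d0 dsym dtri dcomp [x0 Hx0] Hcov.
  apply NNPP; intros Hno.
  assert (Hstep : forall n x r, D x -> 0 < r -> exists x' r', D x' /\ 0 < r' /\ r' <= r / 2 /\
     d x x' + r' <= r /\ forall w, D w -> d x' w <= r' -> ~ W n w).
  { intros n x r Hx Hr. apply NNPP; intros Hn. apply Hno. exists n, x, r.
    repeat split; auto. intros x' Hx' Hd eps Heps. apply NNPP; intros Hw. apply Hn.
    (* Half of [eps], so that the closed ball of radius [r'] lies in the open [eps]-ball that misses
       [W n]; half of [r], so that the radii tend to 0; [r - d x x'], so that the new ball stays
       inside the old one. *)
    set (r' := Rmin (eps / 2) (Rmin (r / 2) (r - d x x'))).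
    assert (r' <= eps / 2) by apply Rmin_l.
    assert (r' <= Rmin (r / 2) (r - d x x')) by apply Rmin_r.
    assert (Rmin (r / 2) (r - d x x') <= r / 2) by apply Rmin_l.
    assert (Rmin (r / 2) (r - d x x') <= r - d x x') by apply Rmin_r.
    assert (0 < r') by (repeat apply Rmin_glb_lt; lra).
    exists x', r'. repeat split; auto; try lra.
    intros w Dw Hxw Ww. apply Hw. exists w. repeat split; auto. lra. }
  pose (S := {p : T * R | D (fst p) /\ 0 < snd p}).
  assert (Hstep' : forall n (s : S), exists s' : S,
     snd (proj1_sig s') <= snd (proj1_sig s) / 2 /\
     d (fst (proj1_sig s)) (fst (proj1_sig s')) + snd (proj1_sig s') <= snd (proj1_sig s) /\
     forall w, D w -> d (fst (proj1_sig s')) w <= snd (proj1_sig s') -> ~ W n w).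
  { intros n [[x r] [Hx Hr]]; simpl in *.
    destruct (Hstep n x r Hx Hr) as (x' & r' & H1 & H2 & H3 & H4 & H5).
    exists (exist _ (x', r') (conj H1 H2)); simpl; auto. }
  pose (next n s := proj1_sig (constructive_indefinite_description _ (Hstep' n s))).
  assert (Hnext : forall n s, let s' := next n s in
     snd (proj1_sig s') <= snd (proj1_sig s) / 2 /\
     d (fst (proj1_sig s)) (fst (proj1_sig s')) + snd (proj1_sig s') <= snd (proj1_sig s) /\
     forall w, D w -> d (fst (proj1_sig s')) w <= snd (proj1_sig s') -> ~ W n w).
  { intros n s; exact (proj2_sig (constructive_indefinite_description _ (Hstep' n s))). }
  pose (s0 := exist (fun p : T * R => D (fst p) /\ 0 < snd p) (x0, 1) (conj Hx0 Rlt_0_1) : S).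
  pose (sq := fix sq n := match n with O => s0 | Datatypes.S m => next m (sq m) end).
  pose (x n := fst (proj1_sig (sq n))). pose (r n := snd (proj1_sig (sq n))).
  assert (Dx : forall n, D (x n)) by (intros n; exact (proj1 (proj2_sig (sq n)))).
  assert (Hr : forall n, 0 < r n) by (intros n; exact (proj2 (proj2_sig (sq n)))).
  assert (H1 : forall n, r (Datatypes.S n) <= r n / 2) by (intros n; exact (proj1 (Hnext n (sq n)))).
  assert (H2 : forall n, d (x n) (x (Datatypes.S n)) + r (Datatypes.S n) <= r n)
    by (intros n; exact (proj1 (proj2 (Hnext n (sq n))))).
  assert (H3 : forall n w, D w -> d (x (Datatypes.S n)) w <= r (Datatypes.S n) -> ~ W n w)
    by (intros n; exact (proj2 (proj2 (Hnext n (sq n))))).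
  clearbody x r. clear - d0 dsym dtri dcomp Dx Hr H1 H2 H3 Hcov.
  assert (Hrn : forall n, r n <= r 0%nat / 2 ^ n).
  { induction n as [|n IH]; [simpl; lra|].
    specialize (H1 n). assert (0 < 2 ^ n) by (apply pow_lt; lra). simpl.
    replace (r 0%nat / (2 * 2 ^ n)) with (r 0%nat / 2 ^ n / 2) by (field; lra). lra. }
  assert (Hnest : forall n k, d (x n) (x (n + k)%nat) + r (n + k)%nat <= r n).
  { intros n k; induction k as [|k IH]; [rewrite Nat.add_0_r, d0; lra|].
    rewrite Nat.add_succ_r. specialize (H2 (n + k)%nat).
    pose proof (dtri (x n) (x (n + k)%nat) (x (Datatypes.S (n + k)))). lra. }
  destruct (dcomp x Dx) as [l [Dl Hl]].
  { intros eps He. destruct (inv_pow2_small (r 0%nat) (eps / 4)) as [N HN]; [lra|].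
    exists N. intros m n Hm Hn. pose proof (Hrn N).
    pose proof (Hnest N (m - N)%nat) as A. pose proof (Hnest N (n - N)%nat) as B.
    replace (N + (m - N))%nat with m in A by lia. replace (N + (n - N))%nat with n in B by lia.
    pose proof (dtri (x m) (x N) (x n)). pose proof (Hr m). pose proof (Hr n).
    rewrite (dsym (x m) (x N)) in *. lra. }
  destruct (Hcov l Dl) as [n Hn]. apply (H3 n l Dl); [|exact Hn].
  apply Rnot_lt_le; intros Hlt.
  destruct (Hl (d (x (Datatypes.S n)) l - r (Datatypes.S n))) as [N HN]; [lra|].
  specialize (HN (Datatypes.S n + N)%nat ltac:(lia)).
  pose proof (Hnest (Datatypes.S n) N) as A. pose proof (Hr (Datatypes.S n + N)%nat).
  pose proof (dtri (x (Datatypes.S n)) (x (Datatypes.S n + N)%nat) l). lra.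
Qed.

(** * Gauges, partitions and the Henstock integral *)

Definition lo (p : R * R * R) : R := fst (fst p).
Definition hi (p : R * R * R) : R := snd (fst p).
Definition tag (p : R * R * R) : R := snd p.

(* Systems of tagged intervals: gaps and degenerate intervals are allowed. *)
Fixpoint partial_partition (c d : R) (P : list (R * R * R)) : Prop :=
  match P with
  | [] => c <= d
  | p :: P' => c <= lo p /\ lo p <= tag p <= hi p /\ partial_partition (hi p) d P'
  end.

Lemma partial_partition_le c d P : partial_partition c d P -> c <= d.
Proof.
  revert c; induction P as [|p P IH]; simpl; intros c H; [easy|].
  destruct H as (H1 & H2 & H3); apply IH in H3; lra.
Qed.

Lemma partial_partition_weaken c c' d P :
  c' <= c -> partial_partition c d P -> partial_partition c' d P.
Proof. destruct P; simpl; intuition lra. Qed.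

Lemma partial_partition_filter (b : R * R * R -> bool) c d P :
  partial_partition c d P -> partial_partition c d (filter b P).
Proof.
  revert c; induction P as [|p P IH]; simpl; intros c H; [easy|].
  destruct H as (H1 & H2 & H3). specialize (IH _ H3).
  destruct (b p); simpl; [tauto|]. eapply partial_partition_weaken; [|exact IH]. lra.
Qed.

Lemma partial_partition_in c d P p : partial_partition c d P -> In p P ->
  c <= lo p /\ lo p <= tag p <= hi p /\ hi p <= d.
Proof.
  revert c; induction P as [|q P IH]; simpl; intros c H Hp; [easy|].
  destruct H as (H1 & H2 & H3). destruct Hp as [->|Hp].
  - apply partial_partition_le in H3; lra.
  - specialize (IH _ H3 Hp). lra.
Qed.

Lemma partial_partition_length c d P : partial_partition c d P ->
  lsum (fun p => hi p - lo p) P <= d - c.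
Proof.
  revert c; induction P as [|p P IH]; simpl; intros c H; [lra|].
  destruct H as (H1 & H2 & H3). specialize (IH _ H3). lra.
Qed.

Lemma tagged_partition_partial c d P : tagged_partition c d P -> partial_partition c d P.
Proof.
  revert c; induction P as [|[[u z] t] P IH]; simpl; intros c H; [lra|].
  destruct H as (H1 & H2 & H3 & H4 & H5). unfold lo, hi, tag; simpl. split; [lra|split;[lra|auto]].
Qed.

Lemma tagged_partition_lt c d P p : tagged_partition c d P -> In p P -> lo p < hi p.
Proof.
  revert c; induction P as [|[[u z] t] P IH]; simpl; intros c H Hp; [easy|].
  destruct H as (H1 & H2 & H3 & H4 & H5). destruct Hp as [<-|Hp]; [exact H2 | eauto].
Qed.

Lemma tagged_partition_app c m d P Q :
  tagged_partition c m P -> tagged_partition m d Q -> tagged_partition c d (P ++ Q).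
Proof.
  revert c; induction P as [|[[u z] t] P IH]; simpl; intros c HP HQ; [now subst|].
  intuition.
Qed.

Lemma tagged_partition_sum (F : R -> R) c d P : tagged_partition c d P ->
  lsum (fun p => F (hi p) - F (lo p)) P = F d - F c.
Proof.
  revert c; induction P as [|[[u z] t] P IH]; simpl; intros c H; [subst; lra|].
  destruct H as (H1 & H2 & H3 & H4 & H5). rewrite (IH _ H5). unfold lo, hi; simpl. subst; lra.
Qed.

Lemma delta_fineE delta P : delta_fine delta P <->
  forall p, In p P -> tag p - delta (tag p) < lo p /\ hi p < tag p + delta (tag p).
Proof.
  unfold delta_fine. rewrite Forall_forall. split; intros H.
  - intros [[u z] t] Hp. exact (H _ Hp).
  - intros [[u z] t] Hp. exact (H _ Hp).
Qed.

Lemma delta_fine_app delta P Q :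
  delta_fine delta P -> delta_fine delta Q -> delta_fine delta (P ++ Q).
Proof. intros; apply Forall_app; auto. Qed.

Lemma delta_fine_min delta1 delta2 P :
  delta_fine (fun t => Rmin (delta1 t) (delta2 t)) P -> delta_fine delta1 P /\ delta_fine delta2 P.
Proof.
  rewrite !delta_fineE; intros H; split; intros p Hp; specialize (H p Hp); simpl in H;
    pose proof (Rmin_l (delta1 (tag p)) (delta2 (tag p)));
    pose proof (Rmin_r (delta1 (tag p)) (delta2 (tag p))); lra.
Qed.

Lemma riemann_sumE h P : riemann_sum h P = lsum (fun p => h (tag p) * (hi p - lo p)) P.
Proof.
  induction P as [|[[u z] t] P IH]; simpl; [easy|]. fold (riemann_sum h P). rewrite IH. reflexivity.
Qed.

Lemma riemann_sum_app h P Q : riemann_sum h (P ++ Q) = riemann_sum h P + riemann_sum h Q.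
Proof. rewrite !riemann_sumE; apply lsum_app. Qed.

(** Let [sg] be the supremum of the points that a fine partition reaches from [c]. Some reachable
    [s] is within [delta sg] of [sg], and one more interval, tagged at [sg], leads from [s] beyond
    [sg] unless it stops at [d]. *)
Lemma cousin (delta : R -> R) (c d : R) :
  c <= d -> (forall t, c <= t <= d -> 0 < delta t) ->
  exists P, tagged_partition c d P /\ delta_fine delta P.
Proof.
  intros Hcd Hdelta.
  set (S s := c <= s <= d /\ exists P, tagged_partition c s P /\ delta_fine delta P).
  assert (Sc : S c) by (split; [lra|]; exists []; split; [reflexivity | constructor]).
  destruct (completeness S) as [sg [Hub Hlub]].
  { exists d; intros s [Hs _]; lra. }
  { now exists c. }
  assert (Hc : c <= sg) by now apply Hub.
  assert (Hd : sg <= d) by (apply Hlub; intros s [Hs _]; lra).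
  assert (Hp : 0 < delta sg) by (apply Hdelta; lra).
  assert (Hs : exists s, S s /\ sg - delta sg < s).
  { apply NNPP; intros Hn. assert (sg <= sg - delta sg); [|lra].
    apply Hlub. intros s Ss. apply Rnot_lt_le; intros Hlt. apply Hn; now exists s. }
  destruct Hs as (s & Ss & Hs). assert (s <= sg) by now apply Hub.
  set (s' := Rmin d (sg + delta sg / 2)).
  assert (s' <= d) by apply Rmin_l. assert (s' <= sg + delta sg / 2) by apply Rmin_r.
  assert (sg <= s') by (apply Rmin_glb; lra).
  assert (Ss' : S s').
  { destruct Ss as [Hcs (P & HP & HPf)]. split; [lra|].
    destruct (Req_dec s s') as [<-|Hne]; [now exists P|].
    exists (P ++ [(s, s', sg)]). split.
    - eapply tagged_partition_app; [exact HP|]. simpl; repeat split; lra.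
    - apply delta_fine_app; [exact HPf|]. repeat constructor; lra. }
  assert (s' <= sg) by now apply Hub.
  assert (Hsd : s' = d) by (unfold s', Rmin in *; destruct (Rle_dec d (sg + delta sg / 2)); lra).
  rewrite Hsd in Ss'. exact (proj2 Ss').
Qed.

Lemma Henstock_integral_unique h c d A B :
  c <= d -> Henstock_integral h c d A -> Henstock_integral h c d B -> A = B.
Proof.
  intros Hcd HA HB. apply NNPP; intros Hne.
  assert (He : 0 < Rabs (A - B) / 2) by (pose proof (Rabs_pos_lt (A - B)); lra).
  destruct (HA _ He) as (d1 & Hd1 & H1). destruct (HB _ He) as (d2 & Hd2 & H2).
  destruct (cousin (fun t => Rmin (d1 t) (d2 t)) c d Hcd) as (P & HP & HPf).
  { intros t Ht; apply Rmin_glb_lt; auto. }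
  apply delta_fine_min in HPf as [HP1 HP2].
  specialize (H1 P HP HP1). specialize (H2 P HP HP2).
  assert (Rabs (A - B) <= Rabs (riemann_sum h P - A) + Rabs (riemann_sum h P - B)).
  { unfold Rabs; repeat destruct Rcase_abs; lra. }
  lra.
Qed.

Lemma Henstock_integral_ext h h' c d A :
  (forall t, h t = h' t) -> Henstock_integral h c d A -> Henstock_integral h' c d A.
Proof.
  intros E H eps He. destruct (H eps He) as (dl & H1 & H2). exists dl; split; [easy|].
  intros P HP HPf. rewrite riemann_sumE.
  rewrite (lsum_ext _ (fun p => h (tag p) * (hi p - lo p))) by (intros; now rewrite E).
  rewrite <- riemann_sumE. auto.
Qed.

Lemma Henstock_integral_linear h1 h2 k c d A B :
  Henstock_integral h1 c d A -> Henstock_integral h2 c d B ->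
  Henstock_integral (fun t => h1 t + k * h2 t) c d (A + k * B).
Proof.
  intros HA HB eps He.
  assert (Hk : 0 < 1 + Rabs k) by (pose proof (Rabs_pos k); lra).
  assert (He2 : 0 < eps / (2 * (1 + Rabs k))) by (apply Rdiv_lt_0_compat; lra).
  destruct (HA (eps / 2)) as (d1 & Hd1 & H1); [lra|].
  destruct (HB _ He2) as (d2 & Hd2 & H2).
  exists (fun t => Rmin (d1 t) (d2 t)); split; [intros t Ht; apply Rmin_glb_lt; auto|].
  intros P HP HPf. apply delta_fine_min in HPf as [HP1 HP2].
  specialize (H1 P HP HP1). specialize (H2 P HP HP2).
  replace (riemann_sum (fun t => h1 t + k * h2 t) P) with (riemann_sum h1 P + k * riemann_sum h2 P).
  2:{ rewrite !riemann_sumE, <- lsum_scal, <- lsum_plus. apply lsum_ext; intros; ring. }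
  replace (_ + _ - _) with ((riemann_sum h1 P - A) + k * (riemann_sum h2 P - B)) by ring.
  eapply Rle_lt_trans; [apply Rabs_triang|]. rewrite Rabs_mult.
  assert (Rabs k * Rabs (riemann_sum h2 P - B) <= (1 + Rabs k) * (eps / (2 * (1 + Rabs k)))).
  { apply Rmult_le_compat; try apply Rabs_pos; lra. }
  replace ((1 + Rabs k) * (eps / (2 * (1 + Rabs k)))) with (eps / 2) in * by (field; lra). lra.
Qed.

(** The integral is the supremum [A] of the numbers that bound all sufficiently fine Riemann sums
    from below. The hypothesis is one-sided because [P] and [Q] may be exchanged. *)
Lemma Henstock_cauchy h c d :
  c <= d ->
  (forall eps, 0 < eps -> exists delta, (forall t, c <= t <= d -> 0 < delta t) /\
     forall P Q, tagged_partition c d P -> delta_fine delta P ->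
       tagged_partition c d Q -> delta_fine delta Q ->
       riemann_sum h P <= riemann_sum h Q + eps) ->
  Henstock_integrable h c d.
Proof.
  intros Hcd HC.
  set (S x := exists delta, (forall t, c <= t <= d -> 0 < delta t) /\
     forall P, tagged_partition c d P -> delta_fine delta P -> x <= riemann_sum h P).
  assert (Hub : forall eps, 0 < eps -> exists delta, (forall t, c <= t <= d -> 0 < delta t) /\
     forall P, tagged_partition c d P -> delta_fine delta P ->
       S (riemann_sum h P - eps) /\ forall x, S x -> x <= riemann_sum h P + eps).
  { intros eps He. destruct (HC eps He) as (dl & Hdl & H). exists dl; split; [easy|].
    intros P HP HPf. split.
    - exists dl; split; [easy|]. intros Q HQ HQf. specialize (H P Q HP HPf HQ HQf). lra.
    - intros x (dx & Hdx & Hx).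
      destruct (cousin (fun t => Rmin (dl t) (dx t)) c d Hcd) as (Q & HQ & HQf).
      { intros t Ht; apply Rmin_glb_lt; auto. }
      apply delta_fine_min in HQf as [HQ1 HQ2].
      specialize (Hx Q HQ HQ2). specialize (H Q P HQ HQ1 HP HPf). lra. }
  destruct (Hub 1 Rlt_0_1) as (d1 & Hd1 & H1).
  destruct (cousin d1 c d Hcd Hd1) as (P1 & HP1 & HP1f).
  destruct (H1 P1 HP1 HP1f) as [HS1 HU1].
  destruct (completeness S) as [A [HA1 HA2]].
  { exists (riemann_sum h P1 + 1). exact HU1. }
  { eexists; exact HS1. }
  exists A. intros eps He. destruct (Hub (eps / 2)) as (dl & Hdl & H); [lra|].
  exists dl; split; [easy|]. intros P HP HPf. destruct (H P HP HPf) as [HS HU].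
  apply HA1 in HS. apply HA2 in HU. apply Rabs_def1; lra.
Qed.

(** Two fine partitions of [[c, d]] are completed by the same fine partitions of [[a, c]] and
    [[d, b]]. The common parts cancel in the difference of the Riemann sums, which leaves the Cauchy
    criterion on [[c, d]]. *)
Lemma Henstock_integrable_sub h a b c d :
  a <= c -> c <= d -> d <= b -> Henstock_integrable h a b -> Henstock_integrable h c d.
Proof.
  intros Hac Hcd Hdb [A HA]. apply Henstock_cauchy; [easy|].
  intros eps He. destruct (HA (eps / 2)) as (dl & Hdl & H); [lra|].
  exists dl; split; [intros t Ht; apply Hdl; lra|].
  intros P Q HP HPf HQ HQf.
  destruct (cousin dl a c Hac) as (P1 & HP1 & HP1f); [intros t Ht; apply Hdl; lra|].
  destruct (cousin dl d b Hdb) as (P2 & HP2 & HP2f); [intros t Ht; apply Hdl; lra|].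
  assert (HX : forall X, tagged_partition c d X -> delta_fine dl X ->
     Rabs (riemann_sum h P1 + riemann_sum h X + riemann_sum h P2 - A) < eps / 2).
  { intros X HX HXf.
    replace (riemann_sum h P1 + riemann_sum h X + riemann_sum h P2)
      with (riemann_sum h (P1 ++ X ++ P2)) by (rewrite !riemann_sum_app; ring).
    apply H.
    - eapply tagged_partition_app; [exact HP1|]. eapply tagged_partition_app; eauto.
    - repeat apply delta_fine_app; auto. }
  pose proof (HX P HP HPf) as B1. pose proof (HX Q HQ HQf) as B2.
  apply Rabs_def2 in B1. apply Rabs_def2 in B2. lra.
Qed.

(** Hilbert's epsilon makes the integral a total function; its value is meaningful only for
    integrable [h]. *)
Definition integral (h : R -> R) (c d : R) : R :=
  epsilon (inhabits 0) (Henstock_integral h c d).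

Lemma integralP h c d :
  Henstock_integrable h c d -> Henstock_integral h c d (integral h c d).
Proof. intros H; exact (epsilon_spec (inhabits 0) _ H). Qed.

Lemma integral_chasles h a b c m d :
  a <= c -> c <= m -> m <= d -> d <= b -> Henstock_integrable h a b ->
  integral h c d = integral h c m + integral h m d.
Proof.
  intros H1 H2 H3 H4 Hint.
  assert (I1 : Henstock_integral h c d (integral h c d))
    by (apply integralP, (Henstock_integrable_sub h a b); auto; lra).
  assert (I2 : Henstock_integral h c m (integral h c m))
    by (apply integralP, (Henstock_integrable_sub h a b); auto; lra).
  assert (I3 : Henstock_integral h m d (integral h m d))
    by (apply integralP, (Henstock_integrable_sub h a b); auto; lra).
  set (A := integral h c d) in *. set (B := integral h c m) in *. set (C := integral h m d) in *.
  apply NNPP; intros Hne.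
  set (e := Rabs (A - (B + C)) / 3).
  assert (He : 0 < e) by (pose proof (Rabs_pos_lt (A - (B + C))); unfold e; lra).
  destruct (I1 e He) as (d1 & Hd1 & K1). destruct (I2 e He) as (d2 & Hd2 & K2).
  destruct (I3 e He) as (d3 & Hd3 & K3).
  destruct (cousin (fun t => Rmin (d1 t) (d2 t)) c m) as (P & HP & HPf); [easy| |].
  { intros t Ht; apply Rmin_glb_lt; [apply Hd1|apply Hd2]; lra. }
  destruct (cousin (fun t => Rmin (d1 t) (d3 t)) m d) as (Q & HQ & HQf); [easy| |].
  { intros t Ht; apply Rmin_glb_lt; [apply Hd1|apply Hd3]; lra. }
  apply delta_fine_min in HPf as [HP1 HP2]. apply delta_fine_min in HQf as [HQ1 HQ2].
  specialize (K1 (P ++ Q) (tagged_partition_app _ _ _ _ _ HP HQ) (delta_fine_app _ _ _ HP1 HQ1)).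
  specialize (K2 P HP HP2). specialize (K3 Q HQ HQ2). rewrite riemann_sum_app in K1.
  assert (Rabs (A - (B + C)) < 3 * e); [|unfold e in *; lra].
  apply Rabs_def2 in K1. apply Rabs_def2 in K2. apply Rabs_def2 in K3. apply Rabs_def1; lra.
Qed.

(** * The Saks-Henstock lemma *)

(** The gaps of [P] are filled with partitions so fine that their Riemann sums nearly equal the
    integrals over the gaps. The error of the completed partition [Q] is then the sum of the errors
    over [P], up to [eta]. *)
Lemma saks_henstock_fill h a b (delta : R -> R) :
  Henstock_integrable h a b -> (forall t, a <= t <= b -> 0 < delta t) ->
  forall P c d eta, a <= c -> d <= b -> 0 < eta ->
  partial_partition c d P -> delta_fine delta P ->
  exists Q, tagged_partition c d Q /\ delta_fine delta Q /\
    Rabs (riemann_sum h Q - integral h c d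
          - lsum (fun p => h (tag p) * (hi p - lo p) - integral h (lo p) (hi p)) P) <= eta.
Proof.
  intros Hint Hdelta.
  assert (Hfill : forall c d eta, a <= c -> c <= d -> d <= b -> 0 < eta ->
    exists Q, tagged_partition c d Q /\ delta_fine delta Q /\
      Rabs (riemann_sum h Q - integral h c d) < eta).
  { intros c d eta Hac Hcd Hdb He.
    destruct (integralP h c d (Henstock_integrable_sub h a b c d Hac Hcd Hdb Hint) eta He)
      as (d1 & Hd1 & H1).
    destruct (cousin (fun t => Rmin (d1 t) (delta t)) c d Hcd) as (Q & HQ & HQf).
    { intros t Ht; apply Rmin_glb_lt; auto. apply Hdelta; lra. }
    apply delta_fine_min in HQf as [HQ1 HQ2]. exists Q; auto. }
  induction P as [|[[u z] t] P IH]; simpl; intros c d eta Hac Hdb He HP HPf.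
  - destruct (Hfill c d eta) as (Q & HQ & HQf & H); auto.
    exists Q; repeat split; auto. rewrite Rminus_0_r. lra.
  - unfold lo, hi, tag in *; simpl in *. destruct HP as (H1 & H2 & H3).
    pose proof (partial_partition_le _ _ _ H3) as Hzd.
    inversion HPf as [|? ? Hf1 Hf2]; subst.
    destruct (Hfill c u (eta / 2)) as (Q1 & HQ1 & HQ1f & E1); try lra.
    destruct (IH z d (eta / 2)) as (Q2 & HQ2 & HQ2f & E2); auto; try lra.
    pose proof (integral_chasles h a b c u d ltac:(lra) ltac:(lra) ltac:(lra) ltac:(lra) Hint) as C1.
    pose proof (integral_chasles h a b u z d ltac:(lra) ltac:(lra) ltac:(lra) ltac:(lra) Hint) as C2.
    set (L := lsum _ P) in *.
    (* A degenerate interval is not allowed in a tagged partition; it is left out, and its term in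
       the Riemann sum is 0. *)
    assert (E : exists Q, tagged_partition u d Q /\ delta_fine delta Q /\
       riemann_sum h Q = h t * (z - u) + riemann_sum h Q2).
    { destruct (Req_dec u z) as [->|Hne].
      - exists Q2; repeat split; auto. ring.
      - exists ((u, z, t) :: Q2). repeat split; auto; try lra. constructor; auto. }
    destruct E as (Q3 & HQ3 & HQ3f & E3).
    exists (Q1 ++ Q3). split; [eapply tagged_partition_app; eauto|].
    split; [now apply delta_fine_app|].
    rewrite riemann_sum_app, E3, C1, C2.
    replace (_ - _ - _) with ((riemann_sum h Q1 - integral h c u)
       + (riemann_sum h Q2 - integral h z d - L)) by ring.
    eapply Rle_trans; [apply Rabs_triang|]. lra.
Qed.

(** Over any fine system the errors add up to at most [eps / 2] in absolute value: [eps / 4] from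
    the gauge and [eps / 4] from filling the gaps. Used separately for the intervals with
    nonnegative and with negative error, this brings the absolute value inside the sum. *)
Lemma saks_henstock h a b :
  Henstock_integrable h a b -> forall eps, 0 < eps ->
  exists delta, (forall t, a <= t <= b -> 0 < delta t) /\
    forall P, partial_partition a b P -> delta_fine delta P ->
      lsum (fun p => Rabs (h (tag p) * (hi p - lo p) - integral h (lo p) (hi p))) P <= eps.
Proof.
  intros Hint eps He.
  destruct (integralP h a b Hint (eps / 4)) as (dl & Hdl & H); [lra|].
  exists dl; split; [easy|]. intros P HP HPf.
  set (f := fun p => h (tag p) * (hi p - lo p) - integral h (lo p) (hi p)).
  assert (HX : forall X, partial_partition a b X -> delta_fine dl X -> Rabs (lsum f X) <= eps / 2).
  { intros X HX HXf.
    destruct (saks_henstock_fill h a b dl Hint Hdl X a b (eps / 4)) as (Q & HQ & HQf & E);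
      auto; try lra.
    specialize (H Q HQ HQf). fold f in E.
    unfold Rabs in *; repeat destruct Rcase_abs; lra. }
  set (b0 := fun p => if Rle_dec 0 (f p) then true else false).
  assert (Hfil : forall b1, delta_fine dl (filter b1 P)).
  { intros b1. rewrite delta_fineE in *. intros p Hp. apply filter_In in Hp. apply HPf, Hp. }
  pose proof (HX _ (partial_partition_filter b0 _ _ _ HP) (Hfil b0)) as K1.
  pose proof (HX _ (partial_partition_filter (fun p => negb (b0 p)) _ _ _ HP) (Hfil _)) as K2.
  rewrite (lsum_filter_split _ b0).
  rewrite (lsum_ext _ f (filter b0 P)).
  2:{ intros p Hp. apply filter_In in Hp as [_ Hp]. unfold b0 in Hp.
      destruct (Rle_dec 0 (f p)); [|easy]. now apply Rabs_pos_eq. }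
  rewrite (lsum_ext _ (fun p => (-1) * f p) (filter (fun p => negb (b0 p)) P)).
  2:{ intros p Hp. apply filter_In in Hp as [_ Hp]. unfold b0 in Hp.
      destruct (Rle_dec 0 (f p)); [easy|]. fold (f p). rewrite Rabs_left by lra. ring. }
  rewrite lsum_scal. unfold Rabs in K1, K2; repeat destruct Rcase_abs; lra.
Qed.

(** * The indefinite integral, extended to the line *)

Definition clamp (a b t : R) : R := Rmax a (Rmin b t).

Lemma clamp_in a b t : a <= b -> a <= clamp a b t <= b.
Proof. intros; unfold clamp, Rmax, Rmin; repeat destruct Rle_dec; lra. Qed.

Lemma clamp_id a b t : a <= t <= b -> clamp a b t = t.
Proof. intros; unfold clamp, Rmax, Rmin; repeat destruct Rle_dec; lra. Qed.

Lemma clamp_mono a b s t : s <= t -> clamp a b s <= clamp a b t.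
Proof. intros; unfold clamp, Rmax, Rmin; repeat destruct Rle_dec; lra. Qed.

Lemma clamp_lip a b s t : a <= b -> s <= t -> clamp a b t - clamp a b s <= t - s.
Proof. intros; unfold clamp, Rmax, Rmin; repeat destruct Rle_dec; lra. Qed.

(* Clamping extends the indefinite integral to all of [R], so that intervals around a point of
   [a, b] can be enlarged without leaving the domain. *)
Definition indef (a b : R) (h : R -> R) (t : R) : R := integral h a (clamp a b t).

Lemma indef_diff a b h u z : a <= b -> Henstock_integrable h a b -> u <= z ->
  indef a b h z - indef a b h u = integral h (clamp a b u) (clamp a b z).
Proof.
  intros Hab Hint Huz. unfold indef.
  pose proof (clamp_in a b u Hab). pose proof (clamp_in a b z Hab).
  pose proof (clamp_mono a b u z Huz).
  rewrite (integral_chasles h a b a (clamp a b u) (clamp a b z)); auto; lra.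
Qed.

Lemma partial_partition_clamp a b c d P :
  a <= b -> partial_partition c d P ->
  partial_partition a b (map (fun p => (clamp a b (lo p), clamp a b (hi p), clamp a b (tag p))) P).
Proof.
  intros Hab H.
  assert (G : partial_partition (clamp a b c) b
    (map (fun p => (clamp a b (lo p), clamp a b (hi p), clamp a b (tag p))) P)).
  { revert c H. induction P as [|p P IH]; simpl; intros c H; [apply clamp_in; lra|].
    destruct H as (H1 & H2 & H3).
    split; [now apply clamp_mono|]. split; [split; apply clamp_mono; lra|]. now apply IH. }
  eapply partial_partition_weaken; [|exact G]. apply clamp_in; lra.
Qed.

(** Only the tags must lie in [[a, b]]; the intervals may stick out. Clamping fixes the tag and
    moves no endpoint away from it, so the clamped system is still fine and [saks_henstock] applies
    to it. *)
Lemma saks_henstock_indef h a b :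
  a <= b -> Henstock_integrable h a b -> forall eps, 0 < eps ->
  exists delta, (forall t, a <= t <= b -> 0 < delta t) /\
    forall c d P, partial_partition c d P -> delta_fine delta P ->
      (forall p, In p P -> a <= tag p <= b) ->
      lsum (fun p => Rabs (h (tag p) * (clamp a b (hi p) - clamp a b (lo p))
              - (indef a b h (hi p) - indef a b h (lo p)))) P <= eps.
Proof.
  intros Hab Hint eps He. destruct (saks_henstock h a b Hint eps He) as (dl & Hdl & H).
  exists dl; split; [easy|]. intros c d P HP HPf Ht.
  specialize (H _ (partial_partition_clamp a b c d P Hab HP)).
  rewrite lsum_map in H. eapply Rle_trans; [|apply H].
  - apply lsum_le. intros p Hp.
    change (Rabs (h (tag p) * (clamp a b (hi p) - clamp a b (lo p))
              - (indef a b h (hi p) - indef a b h (lo p)))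
      <= Rabs (h (clamp a b (tag p)) * (clamp a b (hi p) - clamp a b (lo p))
              - integral h (clamp a b (lo p)) (clamp a b (hi p)))).
    rewrite (clamp_id a b (tag p)) by auto.
    pose proof (partial_partition_in _ _ _ _ HP Hp) as Hin.
    rewrite <- indef_diff; auto; lra.
  - rewrite delta_fineE in *. intros q Hq. apply in_map_iff in Hq as (p & <- & Hp).
    pose proof (partial_partition_in _ _ _ _ HP Hp) as Hin.
    specialize (Ht p Hp). specialize (HPf p Hp).
    change (clamp a b (tag p) - dl (clamp a b (tag p)) < clamp a b (lo p)
      /\ clamp a b (hi p) < clamp a b (tag p) + dl (clamp a b (tag p))).
    rewrite (clamp_id a b (tag p)) by auto.
    revert Ht HPf Hin. unfold clamp, Rmax, Rmin; repeat destruct Rle_dec; intros; lra.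
Qed.

(** For the single interval [[u, z]] tagged at [t], the Saks-Henstock lemma says that the increment
    differs from [h t] times the clamped length by at most [eps / 2]. That length is at most
    [2 * r1], and [r1] is chosen to keep the product below or at [eps / 4]. *)
Lemma indef_continuous h a b t :
  a <= b -> Henstock_integrable h a b -> a <= t <= b -> forall eps, 0 < eps ->
  exists r, 0 < r /\ forall u z, u <= t <= z -> t - r < u -> z < t + r ->
    Rabs (indef a b h z - indef a b h u) < eps.
Proof.
  intros Hab Hint Ht eps He.
  destruct (saks_henstock_indef h a b Hab Hint (eps / 2)) as (dl & Hdl & H); [lra|].
  assert (Hh : 0 < 1 + Rabs (h t)) by (pose proof (Rabs_pos (h t)); lra).
  set (r1 := eps / (8 * (1 + Rabs (h t)))).
  assert (Hr1 : 0 < r1) by (apply Rdiv_lt_0_compat; lra).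
  exists (Rmin (dl t) r1). split; [apply Rmin_glb_lt; auto|].
  intros u z Hut Hu Hz.
  pose proof (Rmin_l (dl t) r1). pose proof (Rmin_r (dl t) r1).
  specialize (H u z [(u, z, t)]). simpl in H. unfold lo, hi, tag in H; simpl in H.
  set (D := indef a b h z - indef a b h u) in *.
  set (c := clamp a b z - clamp a b u) in *.
  assert (Hc : 0 <= c <= 2 * r1).
  { unfold c. pose proof (clamp_mono a b u z). pose proof (clamp_lip a b u z). lra. }
  assert (K : Rabs (h t * c - D) + 0 <= eps / 2).
  { apply H; [repeat split; lra | repeat constructor; lra | intros p [<-|[]]; simpl; lra]. }
  assert (Rabs (h t * c) <= eps / 4).
  { rewrite Rabs_mult, (Rabs_pos_eq c) by lra.
    apply Rle_trans with ((1 + Rabs (h t)) * (2 * r1)).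
    - apply Rmult_le_compat; try apply Rabs_pos; lra.
    - unfold r1. right; field. lra. }
  pose proof (Rabs_triang (h t * c) (-(h t * c - D))) as T.
  replace (h t * c + - (h t * c - D)) with D in T by ring. rewrite Rabs_Ropp in T. lra.
Qed.

Lemma indef_clamp a b h t : a <= b -> indef a b h (clamp a b t) = indef a b h t.
Proof. intros H; unfold indef; now rewrite (clamp_id a b (clamp a b t)) by now apply clamp_in. Qed.

Lemma indef_continuous_everywhere h a b t :
  a <= b -> Henstock_integrable h a b -> forall eps, 0 < eps ->
  exists r, 0 < r /\ forall u z, u <= t <= z -> t - r < u -> z < t + r ->
    Rabs (indef a b h z - indef a b h u) < eps.
Proof.
  intros Hab Hint eps He.
  destruct (indef_continuous h a b (clamp a b t) Hab Hint (clamp_in a b t Hab) eps He)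
    as (r & Hr & H).
  exists r; split; [easy|]. intros u z Hut Hu Hz.
  rewrite <- (indef_clamp a b h z), <- (indef_clamp a b h u) by easy.
  pose proof (clamp_lip a b u t Hab). pose proof (clamp_lip a b t z Hab).
  apply H; [split; apply clamp_mono; lra | lra | lra].
Qed.

Lemma indef_linear a b h1 h2 h k t :
  a <= b -> Henstock_integrable h1 a b -> Henstock_integrable h2 a b ->
  (forall t, h t = h1 t + k * h2 t) ->
  indef a b h t = indef a b h1 t + k * indef a b h2 t.
Proof.
  intros Hab H1 H2 E. unfold indef. pose proof (clamp_in a b t Hab).
  assert (I : Henstock_integral h a (clamp a b t)
     (integral h1 a (clamp a b t) + k * integral h2 a (clamp a b t))).
  { eapply Henstock_integral_ext; [intros s; symmetry; apply E|].
    apply Henstock_integral_linear; apply integralP, (Henstock_integrable_sub _ a b); auto; lra. }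
  eapply Henstock_integral_unique; [|apply integralP; eexists; exact I|exact I]. lra.
Qed.

(** * Banach space preliminaries *)

Definition vsub (X : Banach) (x y : X) : X := vadd X x (vopp X y).

Lemma vadd_cancel (X : Banach) (x y z : X) : vadd X x y = vadd X x z -> y = z.
Proof.
  intros H. rewrite <- (vadd_0 X y), <- (vadd_0 X z), <- (vadd_opp X x).
  rewrite !vadd_assoc, (vadd_comm X y x), (vadd_comm X z x). now rewrite H.
Qed.

Lemma vscal_0 (X : Banach) (x : X) : vscal X 0 x = vzero X.
Proof.
  apply vadd_cancel with (vscal X 0 x). rewrite vadd_0, <- vscal_distr_s. f_equal; ring.
Qed.

Lemma vopp_scal (X : Banach) (x : X) : vopp X x = vscal X (-1) x.
Proof.
  apply vadd_cancel with x. rewrite vadd_opp.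
  rewrite <- (vscal_1 X x) at 1. rewrite <- vscal_distr_s.
  replace (1 + -1) with 0 by ring. now rewrite vscal_0.
Qed.

Lemma vsub_chasles (X : Banach) (x y z : X) : vsub X x z = vadd X (vsub X x y) (vsub X y z).
Proof.
  unfold vsub. rewrite vadd_assoc. f_equal.
  rewrite <- vadd_assoc, (vadd_comm X (vopp X y)), vadd_opp. now rewrite vadd_0.
Qed.

Lemma vsub_swap (X : Banach) (x y : X) : vsub X x y = vscal X (-1) (vsub X y x).
Proof.
  unfold vsub. rewrite !vopp_scal, vscal_distr_v, vscal_assoc.
  replace (-1 * -1) with 1 by ring. now rewrite vscal_1, vadd_comm.
Qed.

Lemma vsub_add (X : Banach) (s w : X) : vsub X (vadd X s w) s = w.
Proof. unfold vsub. now rewrite (vadd_comm X s), <- vadd_assoc, vadd_opp, vadd_0. Qed.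

Lemma vsub_scaled (X : Banach) (k : R) (x s v : X) : k <> 0 ->
  vsub X x (vadd X s (vscal X (/ k) v)) = vscal X (/ k) (vsub X (vscal X k (vsub X x s)) v).
Proof.
  intros Hk. unfold vsub. rewrite !vopp_scal, !vscal_distr_v, !vscal_assoc, vadd_assoc.
  rewrite <- ?Rmult_assoc, Rinv_l, Rmult_1_l, vscal_1, (Rmult_comm (/ k) (-1)) by easy. reflexivity.
Qed.

Lemma vnorm_0 (X : Banach) : vnorm X (vzero X) = 0.
Proof. rewrite <- (vscal_0 X (vzero X)), vnorm_scal, Rabs_R0. ring. Qed.

Lemma vsub_0 (X : Banach) (x : X) : vsub X x (vzero X) = x.
Proof.
  unfold vsub. rewrite vopp_scal. rewrite <- (vscal_0 X x) at 1. rewrite vscal_assoc.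
  replace (-1 * 0) with 0 by ring. now rewrite vscal_0, vadd_0.
Qed.

Lemma vdist_refl (X : Banach) (x : X) : vnorm X (vsub X x x) = 0.
Proof. unfold vsub. now rewrite vadd_opp, vnorm_0. Qed.

Lemma vdist_sym (X : Banach) (x y : X) : vnorm X (vsub X x y) = vnorm X (vsub X y x).
Proof. rewrite vsub_swap, vnorm_scal, Rabs_left by lra. ring. Qed.

Lemma vdist_triangle (X : Banach) (x y z : X) :
  vnorm X (vsub X x z) <= vnorm X (vsub X x y) + vnorm X (vsub X y z).
Proof. rewrite (vsub_chasles X x y z). apply vnorm_triangle. Qed.

Lemma dual_linear (X : Banach) (f : dual X) (x y : X) (k : R) :
  dual_app f (vadd X x (vscal X k y)) = dual_app f x + k * dual_app f y.
Proof. destruct f as [f (H1 & H2 & H3)]; unfold dual_app; simpl. now rewrite H1, H2. Qed.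

Lemma dual_bounded (X : Banach) (f : dual X) :
  exists M, 0 < M /\ forall x, Rabs (dual_app f x) <= M * vnorm X x.
Proof.
  destruct f as [f (H1 & H2 & [M H3])]; unfold dual_app; simpl.
  exists (Rmax M 1). split; [pose proof (Rmax_r M 1); lra|]. intros x.
  eapply Rle_trans; [apply H3|]. apply Rmult_le_compat_r; [apply vnorm_nonneg | apply Rmax_l].
Qed.

Lemma functional_choice {A B : Type} (P : A -> B -> Prop) :
  (forall x, exists y, P x y) -> exists f, forall x, P x (f x).
Proof.
  intros H. exists (fun x => proj1_sig (constructive_indefinite_description _ (H x))).
  intros x. apply proj2_sig.
Qed.

(** One sum over the whole window of indices dominates the difference for every pair in it, so that
    indices that vary from tag to tag can be treated together. *)
Lemma telescope_bound (A : nat -> R) (N len m n : nat) :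
  (N <= m <= N + len)%nat -> (N <= n <= N + len)%nat ->
  Rabs (A n - A m) <= lsum (fun k => Rabs (A (S k) - A k)) (seq N len).
Proof.
  revert m n; induction len as [|len IH]; intros m n Hm Hn.
  - replace n with m by lia. simpl. rewrite Rminus_diag, Rabs_R0. lra.
  - rewrite seq_S, lsum_app; simpl.
    assert (Hpos : 0 <= Rabs (A (S (N + len)) - A (N + len)%nat)) by apply Rabs_pos.
    destruct (Nat.eq_dec m (N + S len)) as [Em|Em]; destruct (Nat.eq_dec n (N + S len)) as [En|En].
    + subst. rewrite Rminus_diag, Rabs_R0.
      assert (0 <= lsum (fun k => Rabs (A (S k) - A k)) (seq N len))
        by (apply lsum_nonneg; intros; apply Rabs_pos). lra.
    + specialize (IH (N + len)%nat n ltac:(lia) ltac:(lia)).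
      replace m with (S (N + len)) by lia.
      unfold Rabs in *; repeat destruct Rcase_abs; lra.
    + specialize (IH m (N + len)%nat ltac:(lia) ltac:(lia)).
      replace n with (S (N + len)) by lia.
      unfold Rabs in *; repeat destruct Rcase_abs; lra.
    + specialize (IH m n ltac:(lia) ltac:(lia)). lra.
Qed.

(** * Strictly separated systems of intervals *)

(** The gaps are strict so that every interval can be enlarged at both ends without meeting its
    neighbours; the intervals themselves may be degenerate. *)
Fixpoint separated (c d : R) (P : list (R * R * R)) : Prop :=
  match P with
  | [] => c < d
  | p :: P' => c < lo p /\ lo p <= tag p <= hi p /\ separated (hi p) d P'
  end.

Lemma separated_shift c d P : separated c d P -> exists m, c < m /\ m <= d /\
  forall c', c' < m -> separated c' d P.
Proof.
  destruct P as [|p P]; simpl; intros H.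
  - exists d; repeat split; auto; lra.
  - exists (lo p). destruct H as (H1 & H2 & H3).
    assert (hi p <= d).
    { clear - H3. revert H3. generalize (hi p). induction P as [|q P IH]; simpl; intros r H; [lra|].
      destruct H as (H1 & H2 & H3). apply IH in H3. lra. }
    repeat split; auto; lra.
Qed.

Lemma separated_widen c d c' d' P : c' <= c -> d <= d' -> separated c d P -> separated c' d' P.
Proof.
  intros Hc Hd. revert c c' Hc. induction P as [|p P IH]; simpl; intros c c' Hc H; [lra|].
  destruct H as (H1 & H2 & H3). repeat split; try lra. apply (IH (hi p)); auto; lra.
Qed.

Fixpoint alternate {A : Type} (l : list A) : list A :=
  match l with
  | x :: _ :: l' => x :: alternate l'
  | _ => l
  end.

Lemma list_ind2 {A : Type} (Q : list A -> Prop) :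
  Q [] -> (forall x, Q [x]) -> (forall x y l, Q l -> Q (x :: y :: l)) -> forall l, Q l.
Proof.
  intros H0 H1 H2 l. enough (Q l /\ forall x, Q (x :: l)) by tauto.
  induction l as [|y l [IH1 IH2]]; auto.
Qed.

Lemma alternate_in {A : Type} (l : list A) x : In x (alternate l) -> In x l.
Proof.
  induction l as [|y|y z l IH] using list_ind2; simpl; auto.
  intros [H|H]; auto.
Qed.

Lemma lsum_alternate {A : Type} (f : A -> R) l :
  lsum f l = lsum f (alternate l) + lsum f (alternate (tl l)).
Proof.
  induction l as [|y|y z l IH] using list_ind2; simpl; try lra.
  rewrite IH. destruct l as [|w l]; simpl; lra.
Qed.

(** The discarded intervals have positive length and become the gaps between the retained ones. *)
Lemma alternate_separated c d c' d' P : c' < c -> d < d' ->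
  partial_partition c d P -> (forall p, In p P -> lo p < hi p) -> separated c' d' (alternate P).
Proof.
  intros Hc Hd. revert c c' Hc.
  induction P as [|p|p q P IH] using list_ind2; simpl; intros c c' Hc H Hlt; [lra| |].
  - destruct H as (H1 & H2 & H3). repeat split; lra.
  - destruct H as (H1 & H2 & H3 & H4 & H5).
    assert (lo q < hi q) by auto.
    repeat split; try lra. apply (IH (hi q)); auto. lra.
Qed.

(** * Boundedness of the integral functionals *)

Section Gelfand.

Context (X : Banach) (a b : R) (g : R -> dual X) (hab : a < b).
Context (Hint : forall y : X, Henstock_integrable (ev_fun y g) a b).

Let hab' : a <= b := Rlt_le _ _ hab.

Definition Phi (y : X) (u z : R) : R :=
  indef a b (ev_fun y g) z - indef a b (ev_fun y g) u.

Lemma Phi_linear x y k u z :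
  Phi (vadd X x (vscal X k y)) u z = Phi x u z + k * Phi y u z.
Proof.
  unfold Phi.
  rewrite !(indef_linear a b (ev_fun x g) (ev_fun y g) (ev_fun (vadd X x (vscal X k y)) g) k) by
    (auto; intros; apply dual_linear). ring.
Qed.

Lemma Phi_add x y u z : Phi (vadd X x y) u z = Phi x u z + Phi y u z.
Proof. rewrite <- (vscal_1 X y) at 1. rewrite Phi_linear. ring. Qed.

Lemma Phi_sub x y u z : Phi (vsub X x y) u z = Phi x u z - Phi y u z.
Proof. unfold vsub. rewrite vopp_scal, Phi_linear. ring. Qed.

Lemma Phi_zero u z : Phi (vzero X) u z = 0.
Proof.
  rewrite <- (vadd_opp X (vzero X)). fold (vsub X (vzero X) (vzero X)). rewrite Phi_sub. ring.
Qed.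

Lemma Phi_scal y k u z : Phi (vscal X k y) u z = k * Phi y u z.
Proof.
  rewrite <- (vadd_0 X (vscal X k y)), vadd_comm, Phi_linear, Phi_zero. ring.
Qed.

Lemma Phi_chasles y u m z : Phi y u z = Phi y u m + Phi y m z.
Proof. unfold Phi; ring. Qed.

Lemma Phi_sum y u z P : tagged_partition u z P ->
  Phi y u z = lsum (fun p => Phi y (lo p) (hi p)) P.
Proof. intros H; symmetry; exact (tagged_partition_sum _ _ _ _ H). Qed.

Lemma Phi_small y t eps : 0 < eps -> exists r, 0 < r /\
  forall u z, u <= t <= z -> t - r < u -> z < t + r -> Rabs (Phi y u z) < eps.
Proof. intros He; apply indef_continuous_everywhere; auto. Qed.

(** * Regular and singular points *)

Definition bounded_on (u z : R) : Prop :=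
  exists C, forall y, Rabs (Phi y u z) <= C * vnorm X y.

Definition regular (t : R) : Prop := exists r, 0 < r /\
  forall u z, t - r < u -> u <= z -> z < t + r -> bounded_on u z.

Definition singular (t : R) : Prop := ~ regular t.

Lemma bounded_on_list P :
  (forall p, In p P -> bounded_on (lo p) (hi p)) ->
  exists C, forall y, Rabs (lsum (fun p => Phi y (lo p) (hi p)) P) <= C * vnorm X y.
Proof.
  induction P as [|p P IH]; simpl; intros H.
  - exists 0. intros y. rewrite Rabs_R0. lra.
  - destruct (H p) as [C1 H1]; auto. destruct IH as [C2 H2]; auto.
    exists (C1 + C2). intros y. eapply Rle_trans; [apply Rabs_triang|].
    specialize (H1 y). specialize (H2 y). lra.
Qed.

Lemma bounded_on_regular u z :
  u <= z -> (forall t, u <= t <= z -> ~ singular t) -> bounded_on u z.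
Proof.
  intros Huz H.
  destruct (functional_choice (fun t r => u <= t <= z -> 0 < r /\
     forall u z, t - r < u -> u <= z -> z < t + r -> bounded_on u z)) as [dl Hdl].
  { intros t. destruct (classic (u <= t <= z)) as [Ht|Ht]; [|exists 0; tauto].
    destruct (NNPP _ (H t Ht)) as [r Hr]. now exists r. }
  destruct (cousin dl u z Huz) as (P & HP & HPf).
  { intros t Ht; apply (Hdl t Ht). }
  destruct (bounded_on_list P) as [C HC].
  - intros p Hp. rewrite delta_fineE in HPf. specialize (HPf p Hp).
    apply tagged_partition_partial in HP.
    pose proof (partial_partition_in _ _ _ _ HP Hp).
    apply (Hdl (tag p)); lra.
  - exists C. intros y. rewrite (Phi_sum y u z P HP). apply HC.
Qed.

Lemma singular_closed t : ~ singular t -> exists r, 0 < r /\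
  forall s, t - r < s < t + r -> ~ singular s.
Proof.
  intros Ht. apply NNPP in Ht as (r & Hr & H). exists r; split; [easy|].
  intros s Hs Es. apply Es. exists (Rmin (s - (t - r)) (t + r - s)).
  pose proof (Rmin_l (s - (t - r)) (t + r - s)). pose proof (Rmin_r (s - (t - r)) (t + r - s)).
  split; [apply Rmin_glb_lt; lra|]. intros u z K1 K2 K3. apply H; lra.
Qed.

(** The clamped indefinite integral is constant beyond [a] and beyond [b]; there [Phi] vanishes and
    every point is regular. *)
Lemma singular_in t : singular t -> a <= t <= b.
Proof.
  intros Ht.
  assert (G : forall u z, u <= z -> z < a \/ b < u -> bounded_on u z).
  { intros u z Huz Ho. exists 0. intros y. unfold Phi, indef.
    replace (clamp a b u) with (clamp a b z).
    - rewrite Rminus_diag, Rabs_R0; lra.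
    - unfold clamp, Rmax, Rmin; repeat destruct Rle_dec; lra. }
  split; apply Rnot_lt_le; intros Hlt; apply Ht.
  - exists (a - t); split; [lra|]. intros u z H1 H2 H3. apply G; lra.
  - exists (t - b); split; [lra|]. intros u z H1 H2 H3. apply G; lra.
Qed.

(* The variation, in the VB* sense, of the indefinite integral of [yg] on the singular points
   of the open interval (c, d). *)
Definition variation_le (y : X) (c d M : R) : Prop :=
  forall P, separated c d P -> (forall p, In p P -> singular (tag p)) ->
    lsum (fun p => Rabs (Phi y (lo p) (hi p))) P <= M.

Lemma variation_le_sub x y c d M M' :
  variation_le x c d M -> variation_le y c d M' -> variation_le (vsub X x y) c d (M + M').
Proof.
  intros Hx Hy P HP HE. specialize (Hx P HP HE). specialize (Hy P HP HE).
  eapply Rle_trans; [|apply Rplus_le_compat; [exact Hx | exact Hy]].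
  rewrite <- lsum_plus. apply lsum_le. intros p _. rewrite Phi_sub.
  unfold Rminus; eapply Rle_trans; [apply Rabs_triang|]. rewrite Rabs_Ropp. lra.
Qed.

Lemma variation_le_scal y c d M k :
  variation_le y c d M -> variation_le (vscal X k y) c d (Rabs k * M).
Proof.
  intros Hy P HP HE. specialize (Hy P HP HE).
  rewrite (lsum_ext _ (fun p => Rabs k * Rabs (Phi y (lo p) (hi p))))
    by (intros; now rewrite Phi_scal, Rabs_mult).
  rewrite lsum_scal. apply Rmult_le_compat_l; [apply Rabs_pos | exact Hy].
Qed.

Lemma variation_le_mono y c d c' d' M M' :
  c <= c' -> d' <= d -> M <= M' -> variation_le y c d M -> variation_le y c' d' M'.
Proof.
  intros H1 H2 H3 H P HP HE. eapply Rle_trans; [|exact H3]. apply H; auto.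
  apply (separated_widen c' d'); auto.
Qed.

(* Adjacent intervals may share an endpoint; every other one gives a separated system. *)
Lemma variation_le_partition y c d M u z P :
  variation_le y c d M -> c < u -> z < d ->
  partial_partition u z P -> (forall p, In p P -> lo p < hi p) ->
  (forall p, In p P -> singular (tag p)) ->
  lsum (fun p => Rabs (Phi y (lo p) (hi p))) P <= 2 * M.
Proof.
  intros Hv Hc Hd HP Hlt HE. rewrite lsum_alternate.
  assert (H1 : lsum (fun p => Rabs (Phi y (lo p) (hi p))) (alternate P) <= M).
  { apply Hv; [eapply alternate_separated; eauto|]. intros p Hp; apply HE; now apply alternate_in. }
  assert (H2 : lsum (fun p => Rabs (Phi y (lo p) (hi p))) (alternate (tl P)) <= M).
  { assert (Htl : forall p, In p (tl P) -> In p P) by (destruct P; simpl; auto).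
    apply Hv.
    - apply (alternate_separated u z); auto.
      destruct P as [|q P]; simpl in *; [easy|]. destruct HP as (K1 & K2 & K3).
      eapply partial_partition_weaken; [|exact K3]. lra.
    - intros p Hp; apply HE, Htl; now apply alternate_in. }
  lra.
Qed.

(** Replaces arbitrary singular tags by tags in a set [Q] that is merely dense among the singular
    points. Each interval is enlarged until its tag is interior, and the tag is moved to a nearby
    point of [Q]. Continuity of the indefinite integral makes the change of the sum at most
    [eta]. *)
Lemma separated_enlarge y (Q : R -> Prop) c0 d :
  (forall e, singular e -> c0 < e < d -> forall eta, 0 < eta ->
     exists w, singular w /\ Q w /\ e - eta < w < e + eta) ->
  forall P c eta, c0 <= c -> 0 < eta -> separated c d P ->
  (forall p, In p P -> singular (tag p)) ->
  exists P', partial_partition c d P' /\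
    (forall p, In p P' -> singular (tag p) /\ Q (tag p)) /\
    lsum (fun p => Rabs (Phi y (lo p) (hi p))) P
      <= lsum (fun p => Rabs (Phi y (lo p) (hi p))) P' + eta.
Proof.
  intros HQ. induction P as [|[[u z] t] P IH]; simpl; intros c eta Hc He HP HE.
  - exists []. simpl; repeat split; try easy; lra.
  - unfold lo, hi, tag in HP; simpl in HP. destruct HP as (H1 & H2 & H3).
    destruct (separated_shift _ _ _ H3) as (m & Hm1 & Hm2 & Hm).
    destruct (Phi_small y u (eta / 4)) as (r1 & Hr1 & K1); [lra|].
    destruct (Phi_small y z (eta / 4)) as (r2 & Hr2 & K2); [lra|].
    (* The enlargement uses part of the gap on the left and stays below [m], so that the tail is
       still separated from [z']. Each endpoint costs [eta / 4], which leaves [eta / 2] for the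
       tail. *)
    set (u' := u - Rmin (r1 / 2) ((u - c) / 2)). set (z' := z + Rmin (r2 / 2) ((m - z) / 2)).
    assert (Hu' : c < u' /\ u - r1 < u' /\ u' < u).
    { unfold u'. pose proof (Rmin_l (r1 / 2) ((u - c) / 2)).
      pose proof (Rmin_r (r1 / 2) ((u - c) / 2)).
      assert (0 < Rmin (r1 / 2) ((u - c) / 2)) by (apply Rmin_glb_lt; lra). lra. }
    assert (Hz' : z < z' /\ z' < z + r2 /\ z' < m).
    { unfold z'. pose proof (Rmin_l (r2 / 2) ((m - z) / 2)).
      pose proof (Rmin_r (r2 / 2) ((m - z) / 2)).
      assert (0 < Rmin (r2 / 2) ((m - z) / 2)) by (apply Rmin_glb_lt; lra). lra. }
    clearbody u' z'.
    destruct (IH z' (eta / 2)) as (P' & HP' & HE' & HS).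
    { lra. } { lra. } { apply Hm; lra. } { intros p Hp; apply HE; auto. }
    assert (Et : singular t) by (apply (HE (u, z, t)); auto).
    destruct (HQ t Et ltac:(lra) (Rmin (t - u') (z' - t))) as (w & Ew & Qw & Hw).
    { apply Rmin_glb_lt; lra. }
    pose proof (Rmin_l (t - u') (z' - t)). pose proof (Rmin_r (t - u') (z' - t)).
    exists ((u', z', w) :: P'). split; [|split].
    + split; [|split; [|exact HP']]; unfold lo, hi, tag; simpl; lra.
    + intros p [<-|Hp]; [now split | now apply HE'].
    + specialize (K1 u' u ltac:(lra) ltac:(lra) ltac:(lra)).
      specialize (K2 z z' ltac:(lra) ltac:(lra) ltac:(lra)).
      assert (Rabs (Phi y u z) <= Rabs (Phi y u' z') + eta / 2).
      { pose proof (Phi_chasles y u' u z'). pose proof (Phi_chasles y u z z').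
        unfold Rabs in *; repeat destruct Rcase_abs; lra. }
      unfold lo, hi in *; simpl in *. lra.
Qed.

(** On [W n] the gauge [dl] exceeds a fixed length and [yg] is bounded by [n]. In a short interval
    every system with tags in [W n] is therefore [dl]-fine, and the Saks-Henstock lemma bounds its
    sum. Where [W n] is dense in the singular set, [separated_enlarge] carries the bound over to all
    singular tags. *)
Lemma variation_le_exists y : (exists e, singular e) ->
  exists c d M e, singular e /\ c < e < d /\ variation_le y c d M.
Proof.
  intros HE.
  destruct (saks_henstock_indef (ev_fun y g) a b hab' (Hint y) 1 Rlt_0_1) as (dl & Hdl & HS).
  set (W (n : nat) t := / INR (S n) < dl t /\ Rabs (ev_fun y g t) <= INR n).
  destruct (baire R singular (fun s t => Rabs (s - t)) W) as (n & e & r & Ee & Hr & HW); auto.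
  - intros; rewrite Rminus_diag; apply Rabs_R0.
  - intros; apply Rabs_minus_sym.
  - intros s t u. replace (s - u) with ((s - t) + (t - u)) by ring. apply Rabs_triang.
  - intros u Hu Hcau. destruct (R_complete u) as [l Hl].
    { intros eps He. destruct (Hcau eps He) as [N HN]. exists N. intros; apply HN; auto. }
    exists l; split.
    + apply NNPP; intros Hn. destruct (singular_closed l Hn) as (r & Hr & K).
      destruct (Hl r Hr) as [N HN]. apply (K (u N)); [|apply Hu].
      specialize (HN N (le_n N)). unfold Rdist in HN. apply Rabs_def2 in HN. lra.
    + intros eps He. destruct (Hl eps He) as [N HN]. exists N. intros k Hk. apply HN; auto.
  - intros t Et. apply singular_in in Et.
    destruct (inv_INR_small (dl t)) as [n1 Hn1]; [auto|].
    destruct (INR_unbounded (Rabs (ev_fun y g t))) as [n2 Hn2].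
    exists (n1 + n2)%nat. split.
    + eapply Rle_lt_trans; [|exact Hn1]. apply Rinv_le_contravar; [apply lt_0_INR; lia|].
      apply le_INR; lia.
    + rewrite plus_INR. pose proof (pos_INR n1). lra.
  - assert (Hn : 0 < / INR (S n)) by (apply Rinv_0_lt_compat, lt_0_INR; lia).
    (* The interval [(e - q, e + q)] has length at most [1 / (n + 1)], which is less than the gauge
       at any tag in [W n]. *)
    set (q := Rmin r (/ INR (S n) / 2)).
    assert (Hq1 : q <= r) by apply Rmin_l. assert (Hq2 : q <= / INR (S n) / 2) by apply Rmin_r.
    assert (Hq : 0 < q) by (apply Rmin_glb_lt; lra).
    (* The 1 is the Saks-Henstock error; the other summand bounds the Riemann sum of absolute values
       by [n] times the total length. *)
    exists (e - q), (e + q), (1 + INR n * (2 * q)), e. split; [easy|]. split; [lra|].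
    intros P HP HPE. apply le_epsilon. intros eta Heta.
    destruct (separated_enlarge y (W n) (e - q) (e + q)) with (P := P) (c := e - q) (eta := eta)
      as (P' & HP' & HE' & HS'); auto; try lra.
    { intros s Es Hs eta' Heta'. destruct (HW s Es) with (eps := eta') as (w & Ew & Ww & Hw); auto.
      - apply Rabs_def1; lra.
      - exists w; repeat split; auto; try apply Ww; apply Rabs_def2 in Hw; lra. }
    eapply Rle_trans; [exact HS'|]. apply Rplus_le_compat_r.
    specialize (HS (e - q) (e + q) P' HP').
    assert (Hfine : delta_fine dl P').
    { apply delta_fineE. intros p Hp. destruct (HE' p Hp) as [_ [Hw _]].
      pose proof (partial_partition_in _ _ _ _ HP' Hp). lra. }
    specialize (HS Hfine ltac:(intros p Hp; apply singular_in, HE'; auto)).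
    apply Rle_trans with
      (lsum (fun p => Rabs (ev_fun y g (tag p) * (clamp a b (hi p) - clamp a b (lo p))
              - (indef a b (ev_fun y g) (hi p) - indef a b (ev_fun y g) (lo p)))) P'
       + INR n * lsum (fun p => hi p - lo p) P').
    + rewrite <- lsum_scal, <- lsum_plus. apply lsum_le. intros p Hp.
      fold (Phi y (lo p) (hi p)).
      pose proof (partial_partition_in _ _ _ _ HP' Hp) as Hin.
      destruct (HE' p Hp) as [_ [_ Hw]].
      pose proof (clamp_mono a b (lo p) (hi p)) as C1.
      pose proof (clamp_lip a b (lo p) (hi p) hab') as C2.
      set (k := clamp a b (hi p) - clamp a b (lo p)) in *.
      assert (Hk : 0 <= k) by (unfold k; lra).
      assert (Rabs (ev_fun y g (tag p) * k) <= INR n * (hi p - lo p)).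
      { rewrite Rabs_mult, (Rabs_pos_eq k) by easy.
        apply Rmult_le_compat; auto; try apply Rabs_pos; apply C2; lra. }
      unfold Rabs in *; repeat destruct Rcase_abs; lra.
    + apply Rplus_le_compat; [exact HS|].
      apply Rmult_le_compat_l; [apply pos_INR|].
      apply partial_partition_length in HP'. lra.
Qed.

(** * Term-by-term integration of series in [X] *)

(** Continuity of the single functional [g t]. The index [N] depends on [t], because the norms of
    the [g t] are not controlled uniformly; this is why tags are later grouped by index. *)
Lemma ev_limit (s : nat -> X) (x : X) :
  (forall eps, 0 < eps -> exists N, forall n, (N <= n)%nat -> vnorm X (vsub X x (s n)) < eps) ->
  forall t N0 eps, 0 < eps -> exists N, (N0 <= N)%nat /\
    Rabs (ev_fun x g t - ev_fun (s N) g t) <= eps.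
Proof.
  intros Hs t N0 eps He. destruct (dual_bounded X (g t)) as (M & HM & HB).
  destruct (Hs (eps / M)) as [N HN]; [now apply Rdiv_lt_0_compat|].
  exists (N0 + N)%nat; split; [lia|]. specialize (HN (N0 + N)%nat ltac:(lia)).
  specialize (HB (vsub X x (s (N0 + N)%nat))).
  unfold vsub in HB at 1. rewrite vopp_scal, dual_linear in HB. unfold ev_fun.
  replace (_ - _) with (dual_app (g t) x + -1 * dual_app (g t) (s (N0 + N)%nat)) by ring.
  eapply Rle_trans; [exact HB|].
  apply Rle_trans with (M * (eps / M)); [apply Rmult_le_compat_l; lra | right; field; lra].
Qed.

(* A Beppo Levi theorem, proved with gauges: each singular tag [t] uses the gauge of a partial
   sum [s (N t)] that is already close to [x] at [t]; the other tags lie in intervals on which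
   [Phi] is continuous in [y]. *)
Lemma Phi_limit_bound c d K (s : nat -> X) x u z e :
  0 <= K -> s O = vzero X ->
  (forall k, variation_le (vsub X (s (S k)) (s k)) c d (K / 2 ^ k)) ->
  (forall eps, 0 < eps -> exists N, forall n, (N <= n)%nat -> vnorm X (vsub X x (s n)) < eps) ->
  c < u -> u < z -> z < d -> u <= e <= z -> singular e ->
  Rabs (Phi x u z) <= 2 * K.
Proof.
  intros HK Hs0 Hvar Hlim Hcu Huz Hzd He Ee.
  (* The summand [2 * K] bounds [Phi (s n) u z]. Of the [6 * eps], five come from the intervals with
     a singular tag and one from the others. *)
  enough (G : forall eps, 0 < eps -> Rabs (Phi x u z) <= 2 * K + 6 * eps).
  { apply le_epsilon. intros eps Heps. specialize (G (eps / 6) ltac:(lra)). lra. }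
  intros eps Heps.
  (* The variations from index [N0] on add up to at most [2 * K / 2 ^ N0]; the bound doubles because
     intervals of a partition share endpoints. *)
  destruct (inv_pow2_small (4 * K) eps Heps) as [N0 HN0].
  destruct (functional_choice (fun t N => (N0 <= N)%nat /\
     Rabs (ev_fun x g t - ev_fun (s N) g t) <= eps / (z - u))) as [N HN].
  { intros t. apply ev_limit; auto. apply Rdiv_lt_0_compat; lra. }
  destruct (saks_henstock_indef (ev_fun x g) a b hab' (Hint x) eps Heps) as (dx & Hdx & Sx).
  (* Each [s m] gets its own gauge with error [eps / 2 ^ m], so that the tags, grouped by the value
     of [N], contribute at most [2 * eps] altogether. *)
  destruct (functional_choice (fun m delta => (forall t, a <= t <= b -> 0 < delta t) /\
    forall c d P, partial_partition c d P -> delta_fine delta P ->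
      (forall p, In p P -> a <= tag p <= b) ->
      lsum (fun p => Rabs (ev_fun (s m) g (tag p) * (clamp a b (hi p) - clamp a b (lo p))
              - Phi (s m) (lo p) (hi p))) P <= eps / 2 ^ m)) as [dm Hdm].
  { intros m. apply saks_henstock_indef; auto. apply Rdiv_lt_0_compat; [easy | apply pow_lt; lra]. }
  destruct (functional_choice (fun t r => 0 < r /\
     (singular t -> r <= dx t /\ r <= dm (N t) t) /\
     (~ singular t -> forall v, t - r < v < t + r -> ~ singular v))) as [dl Hdl].
  { intros t. destruct (classic (singular t)) as [Et|Et].
    - exists (Rmin (dx t) (dm (N t) t)). split; [|split; [|tauto]].
      + pose proof (singular_in t Et). apply Rmin_glb_lt; [auto | now apply Hdm].
      + intros _; split; [apply Rmin_l | apply Rmin_r].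
    - destruct (singular_closed t Et) as (r & Hr & H). exists r; tauto. }
  destruct (cousin dl u z) as (P & HP & HPf); [lra | intros; apply Hdl |].
  rewrite delta_fineE in HPf.
  pose proof (tagged_partition_partial _ _ _ HP) as HPp.
  set (isE := fun p : R * R * R => if excluded_middle_informative (singular (tag p)) then true else false).
  set (PE := filter isE P). set (PN := filter (fun p => negb (isE p)) P).
  assert (HPE : forall p, In p PE -> In p P /\ singular (tag p)).
  { intros p Hp. apply filter_In in Hp as [H1 H2]. split; [easy|].
    unfold isE in H2; destruct excluded_middle_informative; easy. }
  assert (HPEp : partial_partition u z PE) by now apply partial_partition_filter.
  destruct (bounded_on_list PN) as [C HC].
  { intros p Hp. apply filter_In in Hp as [H1 H2].
    assert (NE : ~ singular (tag p)).
    { unfold isE in H2; destruct excluded_middle_informative; easy. }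
    pose proof (partial_partition_in _ _ _ _ HPp H1). specialize (HPf p H1).
    apply bounded_on_regular; [lra|]. intros t Ht.
    destruct (Hdl (tag p)) as (_ & _ & K3). apply (K3 NE). lra. }
  (* The partition, and [C] with it, is already fixed: the gauge [dl] involves [N t] but not [n].
     Hence [n] may be taken large enough to absorb [C]. *)
  assert (Hn : exists n, (N0 <= n)%nat /\
    Rabs (lsum (fun p => Phi (vsub X x (s n)) (lo p) (hi p)) PN) <= eps).
  { assert (HC1 : 0 < 1 + Rabs C) by (pose proof (Rabs_pos C); lra).
    destruct (Hlim (eps / (1 + Rabs C))) as [n Hn]; [now apply Rdiv_lt_0_compat|].
    exists (N0 + n)%nat; split; [lia|]. eapply Rle_trans; [apply HC|].
    specialize (Hn (N0 + n)%nat ltac:(lia)).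
    apply Rle_trans with ((1 + Rabs C) * (eps / (1 + Rabs C))); [|right; field; lra].
    eapply Rle_trans; [apply Rmult_le_compat_r; [apply vnorm_nonneg|]|
      apply Rmult_le_compat_l; [lra | left; exact Hn]].
    pose proof (Rle_abs C); lra. }
  destruct Hn as (n & HN0n & HPN).
  assert (Bsn : Rabs (Phi (s n) u z) <= 2 * K).
  { pose proof (telescope_bound (fun k => Phi (s k) u z) 0 n 0 n ltac:(lia) ltac:(lia)) as T.
    simpl in T. rewrite Hs0, Phi_zero, Rminus_0_r in T.
    eapply Rle_trans; [exact T|].
    eapply Rle_trans; [|pose proof (lsum_geom K 0 n HK) as G; simpl in G;
      replace (2 * K / 1) with (2 * K) in G by field; exact G].
    apply lsum_le. intros k _. rewrite <- Phi_sub.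
    (* The interval [[u, z]] tagged at [e] is by itself a separated system; here the singular point
       in [[u, z]] is used. *)
    specialize (Hvar k [(u, z, e)]). simpl in Hvar. unfold lo, hi, tag in Hvar; simpl in Hvar.
    rewrite Rplus_0_r in Hvar. apply Hvar; [lra|]. now intros p [<-|[]]. }
  assert (BPE : lsum (fun p => Rabs (Phi x (lo p) (hi p) - Phi (s n) (lo p) (hi p))) PE <= 5 * eps).
  { set (cl := fun p : R * R * R => clamp a b (hi p) - clamp a b (lo p)).
    assert (Hcl : forall p, In p PE -> 0 <= cl p <= hi p - lo p).
    { intros p Hp. pose proof (partial_partition_in _ _ _ _ HPEp Hp).
      unfold cl. pose proof (clamp_mono a b (lo p) (hi p)).
      pose proof (clamp_lip a b (lo p) (hi p) hab'). lra. }
    (* The passage from [x] to [s n] on one interval has four costs: the Saks-Henstock error of [x]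
       ([T1]), the change of the integrand at the tag from [x] to [s (N t)] ([T2]), the
       Saks-Henstock error of [s (N t)] ([T3]), and the increments of [s] between the indices [N t]
       and [n] ([T4]). *)
    set (T1 := fun p => Rabs (ev_fun x g (tag p) * cl p - Phi x (lo p) (hi p))).
    set (T2 := fun p => eps / (z - u) * (hi p - lo p)).
    set (T3 := fun p => Rabs (ev_fun (s (N (tag p))) g (tag p) * cl p
                              - Phi (s (N (tag p))) (lo p) (hi p))).
    assert (HL : exists L, (n <= N0 + L)%nat /\ forall p, In p PE -> (N (tag p) <= N0 + L)%nat).
    { clear - HN0n. induction PE as [|p l [L [HL1 HL2]]]; [exists n; split; [lia | easy]|].
      exists (L + N (tag p))%nat; split; [lia|].
      intros q [->|Hq]; [lia | specialize (HL2 q Hq); lia]. }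
    destruct HL as (L & HL1 & HL2).
    set (T4 := fun p => lsum (fun k => Rabs (Phi (s (S k)) (lo p) (hi p) - Phi (s k) (lo p) (hi p)))
                          (seq N0 L)).
    assert (B1 : lsum T1 PE <= eps).
    { apply (Sx u z); auto.
      - apply delta_fineE. intros p Hp. destruct (HPE p Hp) as [K1 K2].
        specialize (HPf p K1). destruct (Hdl (tag p)) as (_ & K3 & _). specialize (K3 K2). lra.
      - intros p Hp. apply singular_in, HPE, Hp. }
    assert (B2 : lsum T2 PE <= eps).
    { unfold T2. rewrite lsum_scal. apply partial_partition_length in HPEp.
      apply Rle_trans with (eps / (z - u) * (z - u)); [|right; field; lra].
      apply Rmult_le_compat_l; [|exact HPEp]. left; apply Rdiv_lt_0_compat; lra. }
    assert (B3 : lsum T3 PE <= 2 * eps).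
    { apply (lsum_by_classes (fun m p => Rabs (ev_fun (s m) g (tag p) * cl p
                              - Phi (s m) (lo p) (hi p))) (fun p => N (tag p))).
      - lra.
      - intros; apply Rabs_pos.
      - intros m. apply (proj2 (Hdm m) u z).
        + now apply partial_partition_filter.
        + apply delta_fineE. intros p Hp. apply filter_In in Hp as [Hp Em].
          apply Nat.eqb_eq in Em. destruct (HPE p Hp) as [K1 K2].
          specialize (HPf p K1). destruct (Hdl (tag p)) as (_ & K3 & _).
          specialize (K3 K2). rewrite Em in K3. lra.
        + intros p Hp. apply filter_In in Hp as [Hp _]. apply singular_in, HPE, Hp. }
    assert (B4 : lsum T4 PE <= eps).
    { unfold T4. rewrite lsum_swap.
      apply Rle_trans with (lsum (fun k => (2 * K) / 2 ^ k) (seq N0 L)).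
      - apply lsum_le. intros k _.
        rewrite (lsum_ext _ (fun p => Rabs (Phi (vsub X (s (S k)) (s k)) (lo p) (hi p))))
          by (intros; now rewrite Phi_sub).
        replace (2 * K / 2 ^ k) with (2 * (K / 2 ^ k)) by (unfold Rdiv; ring).
        apply (variation_le_partition _ c d _ u z); auto.
        + intros p Hp. eapply tagged_partition_lt; [exact HP | apply HPE, Hp].
        + intros p Hp. apply HPE, Hp.
      - eapply Rle_trans; [apply lsum_geom; lra|].
        replace (2 * (2 * K)) with (4 * K) by ring. exact HN0. }
    apply Rle_trans with (lsum (fun p => T1 p + (T2 p + (T3 p + T4 p))) PE).
    - apply lsum_le. intros p Hp. specialize (Hcl p Hp).
      pose proof (telescope_bound (fun k => Phi (s k) (lo p) (hi p)) N0 L n (N (tag p))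
        ltac:(lia) ltac:(split; [apply HN | now apply HL2])) as T.
      fold (T4 p) in T. destruct (HN (tag p)) as [_ HNt].
      assert (HT2 : Rabs ((ev_fun x g (tag p) - ev_fun (s (N (tag p))) g (tag p)) * cl p) <= T2 p).
      { rewrite Rabs_mult, (Rabs_pos_eq (cl p)) by lra.
        unfold T2. apply Rmult_le_compat; try apply Rabs_pos; lra. }
      replace (Phi x (lo p) (hi p) - Phi (s n) (lo p) (hi p)) with
        (- (ev_fun x g (tag p) * cl p - Phi x (lo p) (hi p))
         + ((ev_fun x g (tag p) - ev_fun (s (N (tag p))) g (tag p)) * cl p
         + ((ev_fun (s (N (tag p))) g (tag p) * cl p - Phi (s (N (tag p))) (lo p) (hi p))
         + (Phi (s (N (tag p))) (lo p) (hi p) - Phi (s n) (lo p) (hi p))))) by ring.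
      eapply Rle_trans; [apply Rabs_triang|]. rewrite Rabs_Ropp. apply Rplus_le_compat; [apply Rle_refl|].
      eapply Rle_trans; [apply Rabs_triang|]. apply Rplus_le_compat; [exact HT2|].
      eapply Rle_trans; [apply Rabs_triang|]. apply Rplus_le_compat; [apply Rle_refl | exact T].
    - rewrite !lsum_plus. lra. }
  assert (E1 : Phi x u z = Phi (s n) u z + lsum (fun p => Phi (vsub X x (s n)) (lo p) (hi p)) P).
  { rewrite <- (Phi_sum (vsub X x (s n)) u z P HP), Phi_sub. ring. }
  rewrite (lsum_filter_split _ isE) in E1. fold PE PN in E1. rewrite E1.
  eapply Rle_trans; [apply Rabs_triang|].
  pose proof (Rabs_triang (lsum (fun p => Phi (vsub X x (s n)) (lo p) (hi p)) PE)
    (lsum (fun p => Phi (vsub X x (s n)) (lo p) (hi p)) PN)) as T1.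
  pose proof (lsum_Rabs (fun p => Phi (vsub X x (s n)) (lo p) (hi p)) PE) as T2.
  rewrite (lsum_ext (fun p => Rabs (Phi (vsub X x (s n)) (lo p) (hi p)))
    (fun p => Rabs (Phi x (lo p) (hi p) - Phi (s n) (lo p) (hi p)))) in T2
    by (intros; now rewrite Phi_sub).
  lra.
Qed.

(* Zabreiko's argument: every small [x] is the sum of a series of vectors whose variations
   decrease geometrically. *)
Lemma geometric_expansion c d r M :
  0 < r -> 0 <= M ->
  (forall x, vnorm X x < r -> forall eps, 0 < eps ->
     exists v, variation_le v c d M /\ vnorm X (vsub X x v) < eps) ->
  forall x, vnorm X x < r -> exists s : nat -> X,
    s O = vzero X /\
    (forall k, variation_le (vsub X (s (S k)) (s k)) c d (M / 2 ^ k)) /\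
    (forall eps, 0 < eps -> exists N, forall n, (N <= n)%nat -> vnorm X (vsub X x (s n)) < eps).
Proof.
  intros Hr HM Hd x Hx.
  assert (Hp2 : forall n, 0 < 2 ^ n) by (intros; apply pow_lt; lra).
  destruct (functional_choice (fun (p : nat * X) (s' : X) =>
    vnorm X (vsub X x (snd p)) < r / 2 ^ fst p ->
    vnorm X (vsub X x s') < r / 2 ^ S (fst p) /\
    variation_le (vsub X s' (snd p)) c d (M / 2 ^ fst p))) as [next Hnext].
  { intros [n s]; simpl. specialize (Hp2 n).
    destruct (Rlt_dec (vnorm X (vsub X x s)) (r / 2 ^ n)) as [H|H]; [|exists s; tauto].
    (* The remainder, of norm below [r / 2 ^ n], is scaled up into the ball of radius [r],
       approximated there within [r / 2], and the approximant is scaled back. This halves the bound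
       on the remainder and divides the variation by [2 ^ n]. *)
    destruct (Hd (vscal X (2 ^ n) (vsub X x s))) with (eps := r / 2) as (v & Hv & Hxv); [|lra|].
    { rewrite vnorm_scal, Rabs_pos_eq by lra.
      apply Rlt_le_trans with (2 ^ n * (r / 2 ^ n)); [now apply Rmult_lt_compat_l | right; field; lra]. }
    exists (vadd X s (vscal X (/ 2 ^ n) v)). intros _.
    assert (Hi : 0 < / 2 ^ n) by now apply Rinv_0_lt_compat.
    split.
    - rewrite vsub_scaled by lra. rewrite vnorm_scal, Rabs_pos_eq by lra.
      apply Rlt_le_trans with (/ 2 ^ n * (r / 2)); [now apply Rmult_lt_compat_l | right; field; lra].
    - rewrite vsub_add. replace (M / 2 ^ n) with (Rabs (/ 2 ^ n) * M).
      + now apply variation_le_scal.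
      + rewrite Rabs_pos_eq by lra. unfold Rdiv; ring. }
  set (s := fix s n := match n with O => vzero X | S m => next (m, s m) end).
  assert (Hs : forall n, vnorm X (vsub X x (s n)) < r / 2 ^ n).
  { induction n as [|n IH].
    - simpl. rewrite vsub_0. replace (r / 1) with r by field. exact Hx.
    - exact (proj1 (Hnext (n, s n) IH)). }
  exists s. split; [reflexivity|]. split.
  - intros k. exact (proj2 (Hnext (k, s k) (Hs k))).
  - intros eps He. destruct (inv_pow2_small r eps He) as [N HN]. exists N. intros n Hn.
    eapply Rlt_le_trans; [apply Hs|]. eapply Rle_trans; [|exact HN].
    apply Rmult_le_compat_l; [lra|]. apply Rinv_le_contravar; [auto|].
    apply Rle_pow; [lra | easy].
Qed.

(** * Countably many portions, and the absence of singular points *)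

(** Overlapping intervals of centre [a + i / (k + 1)] and half-width [1 / (k + 1)]. Natural indices
    [i] cover all singular points, since none lies to the left of [a]. *)
Definition portion_lo (i k : nat) : R := a + (INR i - 1) / INR (S k).
Definition portion_hi (i k : nat) : R := a + (INR i + 1) / INR (S k).

(** With [h = 1 / (k + 1)] below half the distance from [e] to [c] and to [d], and [i] the integer
    part of [(e - a) / h], the point [e] lies at most [h] to the right of the centre, and the
    portion stays within [2 * h] of [e]. *)
Lemma portion_exists c d e : c < e < d -> a <= e ->
  exists i k, c <= portion_lo i k /\ portion_lo i k < e < portion_hi i k /\ portion_hi i k <= d.
Proof.
  intros Hcd He.
  destruct (inv_INR_small (Rmin ((e - c) / 2) ((d - e) / 2))) as [k Hk]; [apply Rmin_glb_lt; lra|].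
  pose proof (Rmin_l ((e - c) / 2) ((d - e) / 2)). pose proof (Rmin_r ((e - c) / 2) ((d - e) / 2)).
  assert (Hpos : 0 < INR (S k)) by (apply lt_0_INR; lia).
  assert (Hi : exists i, INR i <= (e - a) * INR (S k) < INR i + 1).
  { assert (Hx : 0 <= (e - a) * INR (S k)) by (apply Rmult_le_pos; lra).
    destruct (archimed ((e - a) * INR (S k))) as [A1 A2].
    set (U := up ((e - a) * INR (S k))) in *.
    assert (0 < U)%Z by (apply lt_IZR; lra).
    exists (Z.to_nat (U - 1)). rewrite INR_IZR_INZ, Z2Nat.id, minus_IZR by lia. lra. }
  destruct Hi as [i [Hi1 Hi2]]. exists i, k.
  assert (E1 : portion_lo i k = a + INR i / INR (S k) - / INR (S k)).
  { unfold portion_lo; field; lra. }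
  assert (E2 : portion_hi i k = a + INR i / INR (S k) + / INR (S k)).
  { unfold portion_hi; field; lra. }
  assert (K1 : INR i / INR (S k) <= e - a).
  { apply Rmult_le_reg_r with (INR (S k)); [easy|]. unfold Rdiv.
    rewrite Rmult_assoc, Rinv_l by lra. lra. }
  assert (K2 : e - a < INR i / INR (S k) + / INR (S k)).
  { apply Rmult_lt_reg_r with (INR (S k)); [easy|]. unfold Rdiv.
    rewrite Rmult_plus_distr_r, Rmult_assoc, Rinv_l by lra. lra. }
  assert (0 < / INR (S k)) by now apply Rinv_0_lt_compat.
  rewrite E1, E2. lra.
Qed.

Lemma no_singular : forall e, ~ singular e.
Proof.
  intros e0 Ee0.
  (* The index [n] codes the triple [(i, k, M)]. The presence of a singular point is part of [W], so
     that the portion selected by Baire's theorem is known to contain one. *)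
  set (W (n : nat) (y : X) :=
    let (i, m) := Cantor.of_nat n in let (k, M) := Cantor.of_nat m in
    (exists e, singular e /\ portion_lo i k < e < portion_hi i k) /\
    variation_le y (portion_lo i k) (portion_hi i k) (INR M)).
  destruct (baire X (fun _ => True) (fun x y => vnorm X (vsub X x y)) W)
    as (n & y0 & r & _ & Hr & HW).
  - apply vdist_refl.
  - apply vdist_sym.
  - apply vdist_triangle.
  - intros u _ Hu. destruct (vcomplete X u Hu) as [l Hl]. exists l; split; [easy | exact Hl].
  - now exists (vzero X).
  - intros y _. destruct (variation_le_exists y) as (c & d & M & e & Ee & He & Hv); [eauto|].
    destruct (portion_exists c d e He) as (i & k & H1 & H2 & H3); [apply singular_in, Ee|].
    destruct (INR_unbounded M) as [M' HM'].
    exists (Cantor.to_nat (i, Cantor.to_nat (k, M'))). unfold W. rewrite !Cantor.cancel_of_to.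
    split; [now exists e|]. apply (variation_le_mono y c d _ _ M); auto; lra.
  - unfold W in HW. clear W. destruct (Cantor.of_nat n) as [i m]. destruct (Cantor.of_nat m) as [k M].
    set (c := portion_lo i k) in *. set (d := portion_hi i k) in *.
    destruct (HW y0 I) with (eps := 1) as (_ & _ & [(e & Ee & He) _] & _);
      [rewrite vdist_refl; easy | lra |].
    assert (HM : 0 <= 2 * INR M) by (pose proof (pos_INR M); lra).
    (* Density around [y0] is transported to the origin: approximants of [y0 + x] and of [y0] are
       subtracted, which doubles the bound on the variation. *)
    assert (Hdense : forall x, vnorm X x < r -> forall eps, 0 < eps ->
       exists v, variation_le v c d (2 * INR M) /\ vnorm X (vsub X x v) < eps).
    { intros x Hx eps Heps.
      destruct (HW (vadd X y0 x) I) with (eps := eps / 2) as (v1 & _ & [_ V1] & D1); [|lra|].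
      { rewrite vdist_sym, vsub_add. exact Hx. }
      destruct (HW y0 I) with (eps := eps / 2) as (v2 & _ & [_ V2] & D2);
        [rewrite vdist_refl; easy | lra |].
      exists (vsub X v1 v2). split.
      - replace (2 * INR M) with (INR M + INR M) by ring. now apply variation_le_sub.
      - replace (vsub X x (vsub X v1 v2)) with (vsub X (vsub X (vadd X y0 x) v1) (vsub X y0 v2)).
        + unfold vsub at 1. rewrite vopp_scal.
          eapply Rle_lt_trans; [apply vnorm_triangle|]. rewrite vnorm_scal, Rabs_left by lra. lra.
        + rewrite <- (vsub_add X y0 x) at 2. unfold vsub.
          rewrite !vopp_scal, !vscal_distr_v, !vscal_assoc, <- !vadd_assoc. f_equal. f_equal.
          rewrite !vadd_assoc. f_equal. apply vadd_comm. }
    apply Ee. exists (Rmin (e - c) (d - e)). split; [apply Rmin_glb_lt; lra|].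
    pose proof (Rmin_l (e - c) (d - e)). pose proof (Rmin_r (e - c) (d - e)).
    intros u z Hu Huz Hz.
    destruct (classic (exists t, u <= t <= z /\ singular t)) as [(t & Ht & Et)|Hno].
    2:{ apply bounded_on_regular; [easy|]. intros t Ht Et. apply Hno; now exists t. }
    destruct (Req_dec u z) as [<-|Hne].
    { exists 0. intros y. unfold Phi. rewrite Rminus_diag, Rabs_R0. lra. }
    (* The vector [y] is scaled to norm [r / 2], inside the ball on which [Phi] is bounded by
       [4 * INR M]. *)
    exists (8 * INR M / r). intros y.
    assert (Hball : forall x, vnorm X x < r -> Rabs (Phi x u z) <= 4 * INR M).
    { intros x Hx.
      destruct (geometric_expansion c d r (2 * INR M) Hr HM Hdense x Hx) as (s & S0 & S1 & S2).
      replace (4 * INR M) with (2 * (2 * INR M)) by ring.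
      apply (Phi_limit_bound c d _ s x u z t); auto; lra. }
    destruct (Req_dec (vnorm X y) 0) as [Hy0|Hy0].
    { rewrite (vnorm_zero X y Hy0), Phi_zero, Rabs_R0, vnorm_0. lra. }
    pose proof (vnorm_nonneg X y).
    assert (Hq : 0 < r / (2 * vnorm X y)) by (apply Rdiv_lt_0_compat; lra).
    specialize (Hball (vscal X (r / (2 * vnorm X y)) y)).
    rewrite vnorm_scal, Phi_scal, Rabs_mult, Rabs_pos_eq in Hball by lra.
    replace (r / (2 * vnorm X y) * vnorm X y) with (r / 2) in Hball by (field; lra).
    specialize (Hball ltac:(lra)).
    apply Rmult_le_reg_l with (r / (2 * vnorm X y)); [easy|].
    eapply Rle_trans; [exact Hball|]. right; field; lra.
Qed.

Lemma Phi_bounded c d : c <= d -> bounded_on c d.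
Proof. intros H; apply bounded_on_regular; [easy | intros; apply no_singular]. Qed.

End Gelfand.

(** * Henstock-Gel'fand integrability *)

Theorem theorem2p1 (X : Banach) (a b : R) (g : R -> dual X) (hab : a < b) :
  Henstock_Gelfand_integrable X g a b <->
  (forall y : X, Henstock_integrable (ev_fun y g) a b).
Proof.
  split; [now intros [H _]|]. intros Hint. split; [exact Hint|].
  intros c d Hac Hcd Hdb.
  assert (HB : is_bounded_linear X (fun y => Phi X a b g y c d)).
  { split; [|split].
    - intros x y. now apply Phi_add.
    - intros k x. now apply Phi_scal.
    - apply (Phi_bounded X a b g hab Hint c d). lra. }
  exists (exist _ _ HB). intros y. unfold dual_app; simpl. unfold Phi.
  (* Inside [[a, b]] clamping is the identity, so [Phi] is the integral over [[c, d]] itself. *)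
  rewrite indef_diff by (auto; lra). rewrite !clamp_id by lra.
  apply integralP, (Henstock_integrable_sub _ a b); auto; lra.
Qed.
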